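(* The well-definedness problem for $\mathrm{PENRC[kind]}$ is decidable: there is an algorithm which, given a $\mathrm{PENRC[kind]}$ expression $e$ and an assignment $\Gamma$ of NRC-types to the free variables of $e$, decides whether $e(\sigma)$ is defined for every environment $\sigma\in\Gamma$.
   Context: **Values, types, kinds.** $\mathcal A$ is an infinite recursively enumerable set of atoms. An NRC-value is (inductively) an atom, a pair $(v_1,v_2)$ of NRC-values, or a finite (possibly heterogeneous) set of NRC-values; atoms, pairs and sets are mutually distinct. For $v=(v_1,v_2)$, $\pi_1(v)=v_1$, $\pi_2(v)=v_2$; $\pi_1,\pi_2$ are undefined on non-pairs. NRC-types: $\tau::=\emptyset\mid\mathbf{atom}\mid\tau\times\tau\mid\tau\cup\tau\mid\mathbf{coll}(\tau)$, denoting respectively the empty set, $\mathcal A$, cartesian product, union, and the set of all finite sets over the denotation of $\tau$. NRC-kinds: $\kappa::=\mathbf{atom}\mid\mathbf{coll}\mid\kappa\times\kappa\mid\kappa\cup\kappa$, denoting respectively $\mathcal A$, the set of all finite sets of NRC-values, cartesian product, and union. Types and kinds are identified with their denotations. **Expressions.** $\mathrm{PENRC[kind]}$ expressions are generated by $$e::=x\mid(e,e)\mid\pi_1(e)\mid\pi_2(e)\mid\emptyset\mid\{e\}\mid e\cup e\mid\textstyle\bigcup e\mid\{e\mid x\in e\}\mid e=e\,?\,e:e\mid e\in\kappa\,?\,e:e,$$ with $x$ ranging over an infinite set of variables; in $\{e_2\mid x\in e_1\}$ the variable $x$ is bound in $e_2$. $FV(e)$ is the set of free variables. **Semantics.** An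 environment $\sigma$ on $e$ maps each $x\in FV(e)$ to an NRC-value; $x:v,\sigma$ is $\sigma$ updated to send $x$ to $v$. The partial semantics is: $x(\sigma)=\sigma(x)$; $(e_1,e_2)(\sigma)=(e_1(\sigma),e_2(\sigma))$; $\pi_i(e)(\sigma)=\pi_i(e(\sigma))$; $\emptyset(\sigma)=\emptyset$; $\{e\}(\sigma)=\{e(\sigma)\}$; $(e_1\cup e_2)(\sigma)=e_1(\sigma)\cup e_2(\sigma)$ (undefined unless both are sets); $(\bigcup e)(\sigma)=\bigcup e(\sigma)$ (undefined unless $e(\sigma)$ is a set of sets); $\{e_2\mid x\in e_1\}(\sigma)=\{e_2(x:v,\sigma)\mid v\in e_1(\sigma)\}$ (undefined unless $e_1(\sigma)$ is a set and every $e_2(x:v,\sigma)$ is defined); $(e_1=e_2\,?\,e_3:e_4)(\sigma)$ is $e_3(\sigma)$ if $e_1(\sigma)=e_2(\sigma)\in\mathcal A$, is $e_4(\sigma)$ if $e_1(\sigma)\neq e_2(\sigma)$ are both in $\mathcal A$, and is undefined otherwise; $(e_1\in\kappa\,?\,e_2:e_3)(\sigma)$ is $e_2(\sigma)$ if $e_1(\sigma)\in\kappa$ and $e_3(\sigma)$ otherwise. An expression is undefined if any value referred to in its clause is undefined (branches not taken are not evaluated). **Type assignments.** A type assignment $\Gamma$ on $e$ maps each $x\in FV(e)$ to an NRC-type; $\sigma\in\Gamma$ means that $\sigma$ and $\Gamma$ have the same domain and $\sigma(x)\in\Gamma(x)$ for all $x$. *)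

(* Defs.v *)
From HB Require Import structures.
From mathcomp Require Import all_boot finmap generic_quotient.

Set Implicit Arguments.
Unset Strict Implicit.
Unset Printing Implicit Defensive.

Local Open Scope fset_scope.
Local Open Scope fmap_scope.
Local Open Scope quotient_scope.

(** A value is an atom, a pair of values or a finite set of values.  Finite sets
cannot be nested directly in an inductive type, so we take finitely branching
trees [pre], quotiented by hereditary set extensionality [sim].  The lemmas
[nodeK], [viewK] and [value_ind] below show that [value] is what it should be:
the least type in bijection with  A + value * value + {fset value}. *)

Inductive pre (A : Type) : Type :=
| PAtom of A
| PPair of pre A & pre A
| PColl of seq (pre A).

Fixpoint pre_all (A : Type) (P : pre A -> Prop) (s : seq (pre A)) : Prop :=
  if s is u :: s' then P u /\ pre_all P s' else True.

Lemma pre_ind' (A : Type) (P : pre A -> Prop) :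
  (forall a, P (PAtom a)) ->
  (forall u v, P u -> P v -> P (PPair u v)) ->
  (forall s, pre_all P s -> P (PColl s)) ->
  forall u, P u.
Proof.
move=> Pa Pp Pc; fix IH 1 => -[a|u v|s]; [exact: Pa|exact: Pp|].
by apply: Pc; elim: s => //= u s IHs; split.
Qed.

Fixpoint pre_enc (A : Type) (u : pre A) : GenTree.tree A :=
  match u with
  | PAtom a => GenTree.Leaf a
  | PPair v w => GenTree.Node 0 [:: pre_enc v; pre_enc w]
  | PColl s => GenTree.Node 1 (map (@pre_enc A) s)
  end.

Fixpoint pre_dec (A : Type) (t : GenTree.tree A) : pre A :=
  match t with
  | GenTree.Leaf a => PAtom a
  | GenTree.Node 0 [:: v; w] => PPair (pre_dec v) (pre_dec w)
  | GenTree.Node _ s => PColl (map (@pre_dec A) s)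
  end.

Lemma pre_encK (A : Type) : cancel (@pre_enc A) (@pre_dec A).
Proof.
elim/pre_ind' => //= [u v -> -> //|s Hs]; congr PColl.
by elim: s Hs => //= u s IHs [-> /IHs ->].
Qed.

HB.instance Definition _ (A : countType) :=
  Countable.copy (pre A) (can_type (@pre_encK A)).

Section Quotient.
Variable A : countType.

Fixpoint sim (u v : pre A) : bool :=
  match u, v with
  | PAtom a, PAtom b => a == b
  | PPair u1 u2, PPair v1 v2 => sim u1 v1 && sim u2 v2
  | PColl s, PColl t =>
      all (fun x => has (fun y => sim x y) t) s &&
      all (fun y => has (fun x => sim x y) s) t
  | _, _ => false
  end.

Lemma pre_allP (P : pre A -> Prop) s :
  pre_all P s <-> {in s, forall u, P u}.
Proof.
elim: s => [|u s IHs] /=; first by split.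
split=> [[Pu /IHs Ps] x|Ps].
  by rewrite inE => /predU1P[->//|/Ps].
by split; [apply: Ps; rewrite mem_head|apply/IHs=> x xs; apply: Ps; rewrite inE xs orbT].
Qed.

Lemma sim_refl : reflexive sim.
Proof.
elim/pre_ind' => [a|u v /= -> ->//|s /pre_allP Hs] /=; first exact: eqxx.
by apply/andP; split; apply/allP=> x xs; apply/hasP; exists x => //; exact: Hs.
Qed.

Lemma sim_sym : symmetric sim.
Proof.
elim/pre_ind' => [a [b| |]|u v IHu IHv [|u' v'|]|s /pre_allP Hs [| |t]] //=.
- by rewrite IHu IHv.
- rewrite andbC; congr andb.
  + apply: eq_all => y; apply: eq_in_has => x xs; exact: Hs.
  + apply: eq_in_all => x xs; apply: eq_has => y; exact: Hs.
Qed.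

Lemma sim_trans : transitive sim.
Proof.
elim/pre_ind' => [a [b|? ?|?] [c|? ?|?]|u v IHu IHv [?|u' v'|?] [?|w w'|?]
  |s /pre_allP Hs [?|? ?|t] [?|? ?|r]] //=.
- by move=> /eqP-> .
- by move=> /andP[/IHu uu /IHv vv] /andP[/uu-> /vv->].
- move=> /andP[/allP ts /allP st] /andP[/allP sr /allP rs].
  apply/andP; split; apply/allP.
  + move=> x /ts/hasP[y ys xy]; have /hasP[z zr yz] := sr _ ys.
    by apply/hasP; exists z => //; apply: Hs yz.
  + move=> z /rs/hasP[y ys yz]; have /hasP[x xt xy] := st _ ys.
    by apply/hasP; exists x => //; apply: Hs yz.
Qed.

Canonical sim_equiv := EquivRel sim sim_refl sim_sym sim_trans.

Definition value := {eq_quot sim_equiv}.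
HB.instance Definition _ := Choice.on value.

Inductive node : Type :=
| NAtom of A
| NPair of value & value
| NColl of {fset value}.

Definition of_node (n : node) : value :=
  match n with
  | NAtom a => \pi_value (PAtom a)
  | NPair v w => \pi_value (PPair (repr v) (repr w))
  | NColl X => \pi_value (PColl (map repr X))
  end.

Definition view (v : value) : node :=
  match repr v with
  | PAtom a => NAtom a
  | PPair u w => NPair (\pi_value u) (\pi_value w)
  | PColl s => NColl [fset \pi_value u | u in s]
  end.

Lemma pi_simP (u v : pre A) : reflect (\pi_value u = \pi_value v) (sim u v).
Proof. exact: (@eqmodP _ sim_equiv u v). Qed.

Lemma sim_repr u : sim (repr (\pi_value u)) u.
Proof. by apply/pi_simP; rewrite reprK. Qed.

Lemma sim_reprP (v : value) u : reflect (v = \pi_value u) (sim (repr v) u).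
Proof. by rewrite -{1}[v]reprK; exact: pi_simP. Qed.

Lemma nodeK : cancel of_node view.
Proof.
case=> [a|v w|X]; rewrite /view /=.
- by have := sim_repr (PAtom a); case: (repr _) => //= b /eqP->.
- have := sim_repr (PPair (repr v) (repr w)).
  case: (repr (\pi_value (PPair _ _))) => //= v' w' /andP[].
  by move=> /pi_simP-> /pi_simP->; rewrite !reprK.
- have := sim_repr (PColl (map repr X)).
  case: (repr (\pi_value (PColl _))) => //= s /andP[/allP sS /allP Ss].
  congr NColl; apply/fsetP=> v; apply/imfsetP/idP => /= [[u /sS]|vS].
    by move=> /hasP[_ /mapP[w wS ->]] /pi_simP -> ->; rewrite reprK.
  have /Ss/hasP[u us /pi_simP uv] : repr v \in map repr X by exact: map_f.
  by exists u => //; rewrite uv reprK.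
Qed.

Lemma viewK : cancel view of_node.
Proof.
move=> v; rewrite /view -[RHS]reprK.
case: (repr v) => [a|u w|s] //=; apply/pi_simP => /=.
- by rewrite !sim_repr.
- apply/andP; split; apply/allP.
    move=> _ /mapP[w /imfsetP[u /= us ->] ->].
    by apply/hasP; exists u => //; exact: sim_repr.
  move=> u us; apply/hasP; exists (repr (\pi_value u)); last exact: sim_repr.
  by apply: map_f; apply/imfsetP; exists u.
Qed.

Lemma value_ind (P : value -> Prop) :
  (forall a, P (of_node (NAtom a))) ->
  (forall v w, P v -> P w -> P (of_node (NPair v w))) ->
  (forall X : {fset value}, {in X, forall v, P v} -> P (of_node (NColl X))) ->
  forall v, P v.
Proof.
move=> Pa Pp Pc v; rewrite -[v]reprK.
elim/pre_ind': (repr v) => [a|u w Pu Pw|s /pre_allP Ps].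
- exact: Pa.
- have := Pp _ _ Pu Pw; congr P; apply/pi_simP => /=; by rewrite !sim_repr.
- have := Pc [fset \pi_value u | u in s]; set w := of_node _.
  have -> : w = \pi_value (PColl s).
    apply/pi_simP => /=; apply/andP; split; apply/allP.
      move=> _ /mapP[x /imfsetP[u /= us ->] ->].
      by apply/hasP; exists u => //; exact: sim_repr.
    move=> u us; apply/hasP; exists (repr (\pi_value u)); last exact: sim_repr.
    by apply: map_f; apply/imfsetP; exists u.
  by apply=> x /imfsetP[u /= us ->]; exact: Ps.
Qed.

End Quotient.

Inductive nrctype : Type :=
| TEmpty
| TAtom
| TProd of nrctype & nrctype
| TUnion of nrctype & nrctype
| TColl of nrctype.

Inductive kind : Type :=
| KAtom
| KColl
| KProd of kind & kind
| KUnion of kind & kind.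

Fixpoint in_type (A : countType) (t : nrctype) (v : value A) : bool :=
  match t with
  | TEmpty => false
  | TAtom => if view v is NAtom _ then true else false
  | TProd t1 t2 =>
      if view v is NPair v1 v2 then in_type t1 v1 && in_type t2 v2 else false
  | TUnion t1 t2 => in_type t1 v || in_type t2 v
  | TColl t1 => if view v is NColl X then all (in_type t1) X else false
  end.

Fixpoint in_kind (A : countType) (k : kind) (v : value A) : bool :=
  match k with
  | KAtom => if view v is NAtom _ then true else false
  | KColl => if view v is NColl _ then true else false
  | KProd k1 k2 =>
      if view v is NPair v1 v2 then in_kind k1 v1 && in_kind k2 v2 else false
  | KUnion k1 k2 => in_kind k1 v || in_kind k2 v
  end.

Definition var := nat.

Inductive expr : Type :=
| EVar of var
| EPair of expr & expr
| EFst of expr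
| ESnd of expr
| EEmpty
| ESing of expr
| EUnion of expr & expr
| EFlatten of expr
| EFor of expr & var & expr          (* EFor e2 x e1  is  { e2 | x in e1 } *)
| EIfEq of expr & expr & expr & expr (* e1 = e2 ? e3 : e4 *)
| EIfKind of expr & kind & expr & expr. (* e1 in k ? e2 : e3 *)

Fixpoint FV (e : expr) : {fset var} :=
  match e with
  | EVar x => [fset x]
  | EEmpty => fset0
  | EFst e1 | ESnd e1 | ESing e1 | EFlatten e1 => FV e1
  | EPair e1 e2 | EUnion e1 e2 => FV e1 `|` FV e2
  | EFor e2 x e1 => FV e1 `|` (FV e2 `\ x)
  | EIfEq e1 e2 e3 e4 => FV e1 `|` FV e2 `|` FV e3 `|` FV e4
  | EIfKind e1 _ e2 e3 => FV e1 `|` FV e2 `|` FV e3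
  end.

Section Semantics.
Variable A : countType.
Notation value := (value A).
Notation env := {fmap var -> value}.

Definition to_set (v : value) : option {fset value} :=
  if view v is NColl X then Some X else None.

Definition of_set (X : {fset value}) : value := of_node (NColl X).

Definition all_defined T (s : seq (option T)) : option (seq T) :=
  if all isSome s then Some (pmap id s) else None.

(* [None] means undefined. *)
Fixpoint eval (e : expr) (s : env) {struct e} : option value :=
  match e with
  | EVar x => s.[? x]
  | EPair e1 e2 =>
      if (eval e1 s, eval e2 s) is (Some v1, Some v2)
      then Some (of_node (NPair v1 v2)) else None
  | EFst e1 =>
      if eval e1 s is Some v then
        if view v is NPair v1 _ then Some v1 else None
      else None
  | ESnd e1 =>
      if eval e1 s is Some v then
        if view v is NPair _ v2 then Some v2 else None
      else None
  | EEmpty => Some (of_set fset0)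
  | ESing e1 =>
      if eval e1 s is Some v then Some (of_set [fset v]) else None
  | EUnion e1 e2 =>
      if (obind to_set (eval e1 s), obind to_set (eval e2 s))
        is (Some X1, Some X2)
      then Some (of_set (X1 `|` X2)) else None
  | EFlatten e1 =>
      if obind to_set (eval e1 s) is Some X then
        if all_defined [seq to_set v | v <- X] is Some XX
        then Some (of_set (\bigcup_(T <- XX) T)) else None
      else None
  | EFor e2 x e1 =>
      if obind to_set (eval e1 s) is Some X then
        if all_defined [seq eval e2 s.[x <- v] | v <- X] is Some ws
        then Some (of_set [fset w | w in ws]) else None
      else None
  | EIfEq e1 e2 e3 e4 =>
      if (eval e1 s, eval e2 s) is (Some v1, Some v2) then
        if (view v1, view v2) is (NAtom a, NAtom b) then
          if a == b then eval e3 s else eval e4 s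
        else None
      else None
  | EIfKind e1 k e2 e3 =>
      if eval e1 s is Some v then
        if in_kind k v then eval e2 s else eval e3 s
      else None
  end.

Definition env_in (s : env) (G : {fmap var -> nrctype}) : Prop :=
  domf s = domf G /\
  forall x v t, s.[? x] = Some v -> G.[? x] = Some t -> in_type t v.

Definition well_defined (e : expr) (G : {fmap var -> nrctype}) : Prop :=
  forall s : env, env_in s G -> eval e s.

End Semantics.

(** Since classical axioms would make any predicate decidable by some function of
Rocq, decidability is stated in a concrete Turing-complete model: first-order
recursive programs over binary trees (as in McCarthy's recursive functions of
symbolic expressions, or the language F of Jones).  A program is a list of
unary, mutually recursive functions; function 0 is the entry point.  The only
primitives are construction of trees and case analysis, evaluated eagerly. *)

Inductive tree : Type := Leaf | Node of tree & tree.

Inductive term : Type :=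
| MVar of nat                  (* de Bruijn index *)
| MLeaf
| MNode of term & term
| MCase of term & term & term  (* the last branch binds left (0), right (1) *)
| MCall of nat & term.

Definition program := seq term.

Inductive exec (p : program) : seq tree -> term -> tree -> Prop :=
| ExVar env i v :
    onth env i = Some v -> exec p env (MVar i) v
| ExLeaf env :
    exec p env MLeaf Leaf
| ExNode env t1 t2 v1 v2 :
    exec p env t1 v1 -> exec p env t2 v2 ->
    exec p env (MNode t1 t2) (Node v1 v2)
| ExCaseLeaf env t t1 t2 v :
    exec p env t Leaf -> exec p env t1 v ->
    exec p env (MCase t t1 t2) v
| ExCaseNode env t t1 t2 l r v :
    exec p env t (Node l r) -> exec p [:: l, r & env] t2 v ->
    exec p env (MCase t t1 t2) v
| ExCall env f t body v w :
    exec p env t v -> onth p f = Some body -> exec p [:: v] body w ->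
    exec p env (MCall f t) w.

Definition computes (p : program) (input output : tree) : Prop :=
  exec p [:: input] (MCall 0 (MVar 0)) output.

Lemma exec_det p env t v w : exec p env t v -> exec p env t w -> v = w.
Proof.
move=> H; elim: H w => {env t v}.
- by move=> env i v vi w; inversion_clear 1; congruence.
- by move=> env w; inversion_clear 1.
- move=> env t1 t2 v1 v2 _ IH1 _ IH2 w; inversion_clear 1.
  by congr Node; [exact: IH1|exact: IH2].
- move=> env t t1 t2 v _ IH _ IH1 w; inversion_clear 1 as [| | |? ? ? ? ? _ e|? ? ? ? ? ? ? e|].
    exact: IH1.
  by have := IH _ e.
- move=> env t t1 t2 l r v _ IH _ IH2 w.
  inversion_clear 1 as [| | |? ? ? ? ? e|? ? ? ? ? ? ? e e'|].
    by have := IH _ e.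
  by apply: IH2; case: (IH _ e) => -> ->.
- move=> env f t body v w _ IH pf _ IHb w'.
  inversion_clear 1 as [| | | | |? ? ? body' v' ? e pf' e'].
  by apply: IHb; rewrite (IH _ e); move: pf'; rewrite pf => -[->].
Qed.

(** A constructor applied to arguments becomes the list of its number, in unary,
followed by its encoded arguments. *)

Fixpoint enc_nat (n : nat) : tree :=
  if n is n'.+1 then Node Leaf (enc_nat n') else Leaf.

Definition enc_bool (b : bool) : tree := if b then Node Leaf Leaf else Leaf.

Definition enc_seq (s : seq tree) : tree := foldr Node Leaf s.

Definition enc_con (c : nat) (args : seq tree) : tree :=
  Node (enc_nat c) (enc_seq args).

Fixpoint enc_type (t : nrctype) : tree :=
  match t with
  | TEmpty => enc_con 0 [::]
  | TAtom => enc_con 1 [::]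
  | TProd t1 t2 => enc_con 2 [:: enc_type t1; enc_type t2]
  | TUnion t1 t2 => enc_con 3 [:: enc_type t1; enc_type t2]
  | TColl t1 => enc_con 4 [:: enc_type t1]
  end.

Fixpoint enc_kind (k : kind) : tree :=
  match k with
  | KAtom => enc_con 0 [::]
  | KColl => enc_con 1 [::]
  | KProd k1 k2 => enc_con 2 [:: enc_kind k1; enc_kind k2]
  | KUnion k1 k2 => enc_con 3 [:: enc_kind k1; enc_kind k2]
  end.

Fixpoint enc_expr (e : expr) : tree :=
  match e with
  | EVar x => enc_con 0 [:: enc_nat x]
  | EPair e1 e2 => enc_con 1 [:: enc_expr e1; enc_expr e2]
  | EFst e1 => enc_con 2 [:: enc_expr e1]
  | ESnd e1 => enc_con 3 [:: enc_expr e1]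
  | EEmpty => enc_con 4 [::]
  | ESing e1 => enc_con 5 [:: enc_expr e1]
  | EUnion e1 e2 => enc_con 6 [:: enc_expr e1; enc_expr e2]
  | EFlatten e1 => enc_con 7 [:: enc_expr e1]
  | EFor e2 x e1 => enc_con 8 [:: enc_expr e2; enc_nat x; enc_expr e1]
  | EIfEq e1 e2 e3 e4 =>
      enc_con 9 [:: enc_expr e1; enc_expr e2; enc_expr e3; enc_expr e4]
  | EIfKind e1 k e2 e3 =>
      enc_con 10 [:: enc_expr e1; enc_kind k; enc_expr e2; enc_expr e3]
  end.

(* An association list, in the order in which finmap enumerates the domain. *)
Definition enc_assignment (G : {fmap var -> nrctype}) : tree :=
  enc_seq [seq Node (enc_nat (val x)) (enc_type (G x)) | x : domf G].

Definition enc_input (e : expr) (G : {fmap var -> nrctype}) : tree :=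
  Node (enc_expr e) (enc_assignment G).

(* Main.v *)
(** Shrinking the sets inside an environment, hereditarily, preserves definedness
and can only shrink the result, since tests look at atoms and kinds but never at
the contents of a set.  Hence only the largest environments matter.  With finitely
many atoms these are finitely many: the type [coll(t)] has a largest value, the
set of all largest values of [t].  It remains to bound the number of atoms.  If
[e] is undefined under an environment, the undefinedness is witnessed by some
elements of sets occurring in the evaluation; tracing these back to the input
yields a small subenvironment under which [e] is still undefined.  Its size is
bounded by a function of [e] and the types, and by equivariance its atoms can be
renamed into any sufficiently large finite set of atoms.

The program represents atoms by trees and takes as atoms all the labellings with
two labels of the leaves of a tree of the appropriate size. *)

From HB Require Import structures.
Require Import Defs.
From mathcomp Require Import all_boot finmap generic_quotient zify.

Set Implicit Arguments.
Unset Strict Implicit.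
Unset Printing Implicit Defensive.

(** * Evaluation on trees representing values *)

(** A set-valued result can lose its offending element when the input shrinks, so undefinedness
    alone does not propagate backwards through a comprehension. What propagates is a lower bound: to
    keep a tree [w] below the result of [e], it suffices to keep certain trees below the values of
    the variables, and their total size grows by at most a factor [H.+2] per constructor of [e].
    Atoms and pairs cannot shrink, so a lower bound has to carry the whole pair skeleton outside
    sets, whose size can be exponential in the nesting of pairs; this is the origin of [H].

    The argument runs on trees rather than on values. Expressions never compare two sets, so they
    cannot see order or repetition in a list, and the program needs no test of set equality. The
    order [lsub] is taken over an arbitrary partial injection of atoms, so that one monotonicity
    lemma covers shrinking as well as renaming in both directions. *)

Section OptionMap.
Variables (T U : Type) (f : T -> option U).

Definition omapM : seq T -> option (seq U) :=
  foldr (fun x acc => if (f x, acc) is (Some y, Some ys) then Some (y :: ys) else None)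
    (Some [::]).

Lemma omapM_Some l ys : omapM l = Some ys -> map f l = map Some ys.
Proof.
elim: l ys => [|x l IH] ys /=; first by case=> <-.
rewrite -/(omapM l); case: (f x) => // y.
by case: (omapM l) IH => // zs IH [<-] /=; rewrite (IH zs).
Qed.

End OptionMap.

Section OptionMapEq.
Variables (T : eqType) (U : Type) (f : T -> option U).

Lemma omapM_None l : omapM f l = None <-> exists2 x, x \in l & f x = None.
Proof.
elim: l => [|x l IH] /=; first by split=> // -[].
rewrite -/(omapM f l); case fx: (f x) => [y|]; last first.
  by split=> // _; exists x; rewrite ?mem_head.
split; last first.
  case=> z; rewrite inE => /predU1P[->|zl fz]; first by rewrite fx.
  by rewrite (proj2 IH) //; exists z.
case E: (omapM f l) => // _; have [z zl fz] := proj1 IH E.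
by exists z => //; rewrite inE zl orbT.
Qed.

Lemma omapM_mem l ys x : omapM f l = Some ys -> x \in l -> exists y, f x = Some y.
Proof.
move=> H xl; case fx: (f x) => [y|]; first by exists y.
by move: H; rewrite (proj2 (omapM_None l)) //; exists x.
Qed.

End OptionMapEq.

Lemma omapM_memr (T U : eqType) (f : T -> option U) l ys y :
  omapM f l = Some ys -> (y \in ys) <-> exists2 x, x \in l & f x = Some y.
Proof.
move=> /omapM_Some H; rewrite -(mem_map (f := Some)); last exact: Some_inj.
by rewrite -H; split=> [/mapP[x xl ->]|[x xl <-]]; [exists x|exact: map_f].
Qed.

Section Pre.
Local Open Scope fset_scope.
Local Open Scope fmap_scope.
Local Open Scope quotient_scope.
Variable A : countType.
Implicit Types u v w : pre A.

Definition penv (T : Type) := var -> option T.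

Definition upd T (x : var) (v : T) (s : penv T) : penv T :=
  fun y => if y == x then Some v else s y.

Fixpoint ptype (t : nrctype) u : bool :=
  match t with
  | TEmpty => false
  | TAtom => if u is PAtom _ then true else false
  | TProd t1 t2 => if u is PPair u1 u2 then ptype t1 u1 && ptype t2 u2 else false
  | TUnion t1 t2 => ptype t1 u || ptype t2 u
  | TColl t1 => if u is PColl l then all (ptype t1) l else false
  end.

Fixpoint pkind (k : kind) u : bool :=
  match k with
  | KAtom => if u is PAtom _ then true else false
  | KColl => if u is PColl _ then true else false
  | KProd k1 k2 => if u is PPair u1 u2 then pkind k1 u1 && pkind k2 u2 else false
  | KUnion k1 k2 => pkind k1 u || pkind k2 u
  end.

Definition pset u : option (seq (pre A)) := if u is PColl l then Some l else None.

Fixpoint peval (e : expr) (s : penv (pre A)) {struct e} : option (pre A) :=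
  match e with
  | EVar x => s x
  | EPair e1 e2 =>
      if (peval e1 s, peval e2 s) is (Some u, Some v) then Some (PPair u v) else None
  | EFst e1 => if peval e1 s is Some (PPair u _) then Some u else None
  | ESnd e1 => if peval e1 s is Some (PPair _ v) then Some v else None
  | EEmpty => Some (PColl [::])
  | ESing e1 => if peval e1 s is Some u then Some (PColl [:: u]) else None
  | EUnion e1 e2 =>
      if (peval e1 s, peval e2 s) is (Some (PColl l), Some (PColl m))
      then Some (PColl (l ++ m)) else None
  | EFlatten e1 =>
      if peval e1 s is Some (PColl l) then
        omap (fun ll => PColl (flatten ll)) (omapM pset l)
      else None
  | EFor e2 x e1 =>
      if peval e1 s is Some (PColl l) then
        omap (@PColl A) (omapM (fun v => peval e2 (upd x v s)) l)
      else None
  | EIfEq e1 e2 e3 e4 =>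
      if (peval e1 s, peval e2 s) is (Some (PAtom a), Some (PAtom b)) then
        if a == b then peval e3 s else peval e4 s
      else None
  | EIfKind e1 k e2 e3 =>
      if peval e1 s is Some u then
        if pkind k u then peval e2 s else peval e3 s
      else None
  end.

Local Notation cls u := (\pi_(value A) u).

Lemma view_atom a : view (cls (PAtom a)) = NAtom a.
Proof. exact: (nodeK (NAtom a)). Qed.

Lemma view_pair u v : view (cls (PPair u v)) = NPair (cls u) (cls v).
Proof.
rewrite -(nodeK (NPair _ _)); congr view; apply/pi_simP => /=.
by rewrite ![sim u _]sim_sym ![sim v _]sim_sym !sim_repr.
Qed.

Lemma cls_coll l : cls (PColl l) = of_set [fset cls u | u in l].
Proof.
apply/esym/pi_simP => /=; apply/andP; split; apply/allP.
  move=> _ /mapP[x /imfsetP[u /= us ->] ->].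
  by apply/hasP; exists u => //; exact: sim_repr.
move=> u us; apply/hasP; exists (repr (cls u)); last exact: sim_repr.
by apply: map_f; apply/imfsetP; exists u.
Qed.

Lemma view_coll l : view (cls (PColl l)) = NColl [fset cls u | u in l].
Proof. by rewrite cls_coll nodeK. Qed.

Lemma of_set_cls (X : {fset value A}) l :
  X =i [seq cls u | u <- l] -> of_set X = cls (PColl l).
Proof.
move=> H; rewrite cls_coll; congr of_set; apply/fsetP=> x; rewrite H.
by apply/mapP/imfsetP => -[u /= ul ->]; exists u.
Qed.

Lemma in_type_cls t u : in_type t (cls u) = ptype t u.
Proof.
elim: t u => //=.
- by case=> [a|u v|l]; rewrite ?view_atom ?view_pair ?view_coll.
- move=> t1 IH1 t2 IH2 [a|u v|l]; rewrite ?view_atom ?view_pair ?view_coll //.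
  by rewrite IH1 IH2.
- by move=> t1 IH1 t2 IH2 u; rewrite IH1 IH2.
- move=> t1 IH1 [a|u v|l]; rewrite ?view_atom ?view_pair ?view_coll //=.
  apply/allP/allP => H u.
    by move=> ul; rewrite -IH1; apply: H; apply/imfsetP; exists u.
  by case/imfsetP=> w /= wl ->; rewrite IH1 H.
Qed.

Lemma in_kind_cls k u : in_kind k (cls u) = pkind k u.
Proof.
elim: k u => //=.
- by case=> [a|u v|l]; rewrite ?view_atom ?view_pair ?view_coll.
- by case=> [a|u v|l]; rewrite ?view_atom ?view_pair ?view_coll.
- move=> t1 IH1 t2 IH2 [a|u v|l]; rewrite ?view_atom ?view_pair ?view_coll //.
  by rewrite IH1 IH2.
- by move=> t1 IH1 t2 IH2 u; rewrite IH1 IH2.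
Qed.

Lemma all_defined_Some T (s : seq (option T)) ws :
  s = map Some ws -> all_defined s = Some ws.
Proof.
move=> ->; rewrite /all_defined all_map /=.
have -> : all (preim Some isSome) ws by elim: ws.
by congr Some; elim: ws => //= w ws ->.
Qed.

Lemma all_defined_None (T : eqType) (s : seq (option T)) :
  None \in s -> all_defined s = None.
Proof. by move=> H; rewrite /all_defined; case: allP => // /(_ _ H). Qed.

Lemma all_isSome_map T (s : seq (option T)) :
  all isSome s -> s = map Some (pmap id s).
Proof. by elim: s => //= -[x|] //= s IH /IH <-. Qed.

(** Shared by flattening and comprehension. The list [l] may name a member of [X] several times, by
    different representatives; since [F] depends only on the class, failures on [l] and on [X]
    correspond and the results agree as sets. *)
Lemma all_defined_map (U : choiceType) (W T : eqType) (c : pre A -> U) (q : W -> T)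
  (l : seq (pre A)) (X : {fset U}) (F : U -> option T) (f : pre A -> option W) :
  X =i map c l -> {in l, forall u, F (c u) = omap q (f u)} ->
  if omapM f l is Some ws
  then exists2 zs, all_defined (map F X) = Some zs & zs =i map q ws
  else all_defined (map F X) = None.
Proof.
move=> XP H; case E: (omapM f l) => [ws|]; last first.
  have [u ul fu] := proj1 (omapM_None f l) E.
  apply: all_defined_None; apply/mapP; exists (c u); last by rewrite H ?fu.
  by rewrite XP map_f.
have D : all isSome (map F X).
  apply/allP=> _ /mapP[x + ->]; rewrite XP => /mapP[u ul ->]; rewrite H //.
  by have [w ->] := omapM_mem E ul.
have eq_zs := all_isSome_map D; move: (pmap _ _) eq_zs => zs eq_zs.
exists zs; first exact: all_defined_Some.
move=> z; rewrite -(mem_map (f := Some)) -?eq_zs; last exact: Some_inj.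
apply/mapP/mapP => [[x]|[w]].
  rewrite XP => /mapP[u ul ->]; rewrite H //.
  have [w fu] := omapM_mem E ul; rewrite fu => -[->].
  by exists w => //; apply/(omapM_memr _ E); exists u.
move=> /(omapM_memr _ E)[u ul fu] ->; exists (c u); last by rewrite H ?fu.
by rewrite XP map_f.
Qed.

Lemma mem_fset_cls l : [fset cls u | u in l] =i [seq cls u | u <- l].
Proof. by move=> x; apply/imfsetP/mapP => -[u /= ul ->]; exists u. Qed.

Lemma to_set_cls u : to_set (cls u) =
  if u is PColl l then Some [fset cls v | v in l] else None.
Proof. by rewrite /to_set; case: u => *; rewrite ?view_atom ?view_pair ?view_coll. Qed.

(** Relating [s] to an arbitrary [p], not to chosen representatives, lets the comprehension case
    extend both environments by any element of the list. *)
Lemma eval_cls e (s : {fmap var -> value A}) (p : penv (pre A)) :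
  (forall x, s.[? x] = omap (fun u => cls u) (p x)) ->
  eval e s = omap (fun u => cls u) (peval e p).
Proof.
elim: e s p => /=.
- by move=> x s p ->.
- move=> e1 IH1 e2 IH2 s p H; rewrite (IH1 _ _ H) (IH2 _ _ H).
  case: (peval e1 p) => // u; case: (peval e2 p) => //= v; congr Some.
  by rewrite -[RHS]viewK view_pair.
- move=> e1 IH1 s p H; rewrite (IH1 _ _ H).
  by case: (peval e1 p) => //= -[a|u v|l]; rewrite ?view_atom ?view_pair ?view_coll.
- move=> e1 IH1 s p H; rewrite (IH1 _ _ H).
  by case: (peval e1 p) => //= -[a|u v|l]; rewrite ?view_atom ?view_pair ?view_coll.
- by move=> s p H; congr Some; apply: of_set_cls => x; rewrite inE.
- move=> e1 IH1 s p H; rewrite (IH1 _ _ H).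
  case: (peval e1 p) => //= u; congr Some; apply: of_set_cls => x.
  by rewrite in_fset1 inE.
- move=> e1 IH1 e2 IH2 s p H; rewrite (IH1 _ _ H) (IH2 _ _ H).
  case: (peval e1 p) => //= u; rewrite to_set_cls.
  case: (peval e2 p) => [v|] /=; last by case: u.
  case: u => // l; rewrite to_set_cls; case: v => //= m; congr Some.
  apply: of_set_cls => x; rewrite map_cat mem_cat in_fsetU.
  by congr orb; apply/imfsetP/mapP => -[u /= ul ->]; exists u.
- move=> e1 IH1 s p H; rewrite (IH1 _ _ H).
  case: (peval e1 p) => //= u; rewrite to_set_cls; case: u => // l.
  have := @all_defined_map _ (seq (pre A)) {fset value A} (fun u => cls u) (fun l => [fset cls v | v in l])
     l _ (@to_set A) pset (mem_fset_cls l).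
  case: (omapM pset l) => /= [ll|->] //; last first.
    by move=> u _; rewrite to_set_cls; case: u.
  case=> [u _|zs -> eq_zs]; first by rewrite to_set_cls; case: u.
  congr Some; apply: of_set_cls => x; apply/bigfcupP/mapP.
    case=> X /=; rewrite andbT eq_zs => /mapP[m ml ->] /imfsetP[u /= um ->].
    by exists u => //; apply/flattenP; exists m.
  case=> u /flattenP[m ml um] ->; exists [fset cls v | v in m].
    by rewrite andbT eq_zs; apply: map_f.
  by apply/imfsetP; exists u.
- move=> e2 IH2 x e1 IH1 s p H; rewrite (IH1 _ _ H).
  case: (peval e1 p) => //= u; rewrite to_set_cls; case: u => // l.
  have := @all_defined_map _ (pre A) (value A) (fun u => cls u) (fun u => cls u)
     l _ (fun z => eval e2 s.[x <- z]) (fun v => peval e2 (upd x v p)) (mem_fset_cls l).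
  have Hx u : u \in l -> eval e2 s.[x <- cls u] = omap (fun u => cls u) (peval e2 (upd x u p)).
    move=> _; apply: IH2 => y; rewrite fnd_set /upd; case: eqP => // _; exact: H.
  case: (omapM _ l) => /= [ws|->] // /(_ Hx)[zs -> eq_zs].
  congr Some; apply: of_set_cls => y; rewrite -eq_zs.
  by apply/imfsetP/idP => [[z /= zz ->]|yz] //; exists y.
- move=> e1 IH1 e2 IH2 e3 IH3 e4 IH4 s p H; rewrite (IH1 _ _ H) (IH2 _ _ H).
  case: (peval e1 p) => //= u; case: (peval e2 p) => [v|] /=; last by case: u.
  case: u => [a|u1 u2|l]; rewrite ?view_atom ?view_pair ?view_coll //.
  case: v => [b|u1 u2|l]; rewrite ?view_atom ?view_pair ?view_coll //.
  by rewrite (IH3 _ _ H) (IH4 _ _ H); case: eqP.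
- move=> e1 IH1 k e2 IH2 e3 IH3 s p H; rewrite (IH1 _ _ H).
  case: (peval e1 p) => //= u; rewrite in_kind_cls (IH2 _ _ H) (IH3 _ _ H).
  by case: pkind.
Qed.

End Pre.

(** * Monotonicity and provenance *)

Section Sub.
Variables (A B : countType) (R : A -> B -> bool).

(** The lower (Hoare) preorder on finite sets, applied hereditarily, with atoms compared by [R].
    Equality gives the shrinking order, the graph of a map a renaming of atoms. *)
Fixpoint lsub (u : pre A) (v : pre B) {struct u} : bool :=
  match u, v with
  | PAtom a, PAtom b => R a b
  | PPair u1 u2, PPair v1 v2 => lsub u1 v1 && lsub u2 v2
  | PColl l, PColl m => all (fun x => has (fun y => lsub x y) m) l
  | _, _ => false
  end.

Definition esub (s : penv (pre A)) (s' : penv (pre B)) : Prop :=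
  forall x, match s x, s' x with
            | Some u, Some v => lsub u v
            | None, None => true
            | _, _ => false
            end.

Lemma esub_upd x u v s s' : esub s s' -> lsub u v -> esub (upd x u s) (upd x v s').
Proof. by move=> H uv y; rewrite /upd; case: eqP => // _; exact: H. Qed.

Lemma lsub_collP l m :
  reflect (forall u, u \in l -> exists2 v, v \in m & lsub u v) (lsub (PColl l) (PColl m)).
Proof.
apply: (iffP allP) => /= H u /H; first by case/hasP=> v vm uv; exists v.
by case=> v vm uv; apply/hasP; exists v.
Qed.

Lemma pkind_lsub k u v : lsub u v -> pkind k u = pkind k v.
Proof.
elim: k u v => //= [|| k1 IH1 k2 IH2|k1 IH1 k2 IH2].
- by case=> [a|u1 u2|l] [b|v1 v2|m].
- by case=> [a|u1 u2|l] [b|v1 v2|m].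
- by case=> [a|u1 u2|l] [b|v1 v2|m] //= /andP[/IH1 -> /IH2 ->].
- by move=> u v uv; rewrite (IH1 _ _ uv) (IH2 _ _ uv).
Qed.

Hypothesis R_bij : forall a a' b b', R a b -> R a' b' -> (a == a') = (b == b').

(** Equality tests have the same outcome on both sides because [R] preserves and reflects equality,
    kind tests because kinds do not look into sets. An element on which the body could fail lies
    below one on which it is defined. *)
Lemma peval_lsub e s s' v :
  esub s s' -> peval e s' = Some v -> exists2 u, peval e s = Some u & lsub u v.
Proof.
elim: e s s' v => /=.
- move=> x s s' v /(_ x); case: (s x) => [u|]; case: (s' x) => // w uw [<-].
  by exists u.
- move=> e1 IH1 e2 IH2 s s' v H.
  case E1: (peval e1 s') => [v1|] //; case E2: (peval e2 s') => [v2|] // [<-].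
  have [u1 -> uv1] := IH1 _ _ _ H E1; have [u2 -> uv2] := IH2 _ _ _ H E2.
  by exists (PPair u1 u2); rewrite //= uv1.
- move=> e1 IH1 s s' v H.
  case E1: (peval e1 s') => [[a|v1 v2|l]|] // [<-].
  have [[a|u1 u2|l] -> //= /andP[uv1 uv2]] := IH1 _ _ _ H E1.
  by exists u1.
- move=> e1 IH1 s s' v H.
  case E1: (peval e1 s') => [[a|v1 v2|l]|] // [<-].
  have [[a|u1 u2|l] -> //= /andP[uv1 uv2]] := IH1 _ _ _ H E1.
  by exists u2.
- by move=> s s' v H [<-]; exists (PColl [::]).
- move=> e1 IH1 s s' v H.
  case E1: (peval e1 s') => [v1|] // [<-].
  have [u1 -> uv1] := IH1 _ _ _ H E1; exists (PColl [:: u1]) => //=.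
  by rewrite uv1.
- move=> e1 IH1 e2 IH2 s s' v H.
  case E1: (peval e1 s') => [[a|? ?|l1]|] //; case E2: (peval e2 s') => [[a|? ?|l2]|] // [<-].
  have [[a|? ?|m1] -> // /lsub_collP uv1] := IH1 _ _ _ H E1.
  have [[a|? ?|m2] -> // /lsub_collP uv2] := IH2 _ _ _ H E2.
  exists (PColl (m1 ++ m2)) => //; apply/lsub_collP => u.
  rewrite mem_cat => /orP[/uv1|/uv2] [w wl uw]; exists w => //;
    by rewrite mem_cat wl ?orbT.
- move=> e1 IH1 s s' v H.
  case E1: (peval e1 s') => [[a|? ?|l]|] //; case El: (omapM _ _) => [ll|] //= [<-].
  have [[a|? ?|m] -> // /lsub_collP ml] := IH1 _ _ _ H E1.
  case Em: (omapM _ _) => [mm|] /=; last first.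
    have [x /ml [y yl xy] x_nset] := proj1 (omapM_None _ _) Em.
    have [z] := omapM_mem El yl.
    by case: x y x_nset xy {yl} => [?|? ?|?] [?|? ?|?].
  exists (PColl (flatten mm)) => //; apply/lsub_collP => u /flattenP[c].
  move=> /(omapM_memr _ Em)[[|? ?|n] // /ml[y yl yn] [Ec]] uc.
  rewrite -{}Ec in uc; case: y yl yn => // d dl /lsub_collP/(_ _ uc)[w wd uw]; exists w => //.
  by apply/flattenP; exists d => //; apply/(omapM_memr _ El); exists (PColl d).
- move=> e2 IH2 x e1 IH1 s s' v H.
  case E1: (peval e1 s') => [[a|? ?|l]|] //; case El: (omapM _ _) => [ll|] //= [<-].
  have [[a|? ?|m] -> // /lsub_collP ml] := IH1 _ _ _ H E1.
  have mlP u : u \in m -> exists2 w, w \in ll &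
      exists2 u', peval e2 (upd x u s) = Some u' & lsub u' w.
    case/ml=> y yl uy; have [w Ew] := omapM_mem El yl.
    exists w; first by apply/(omapM_memr _ El); exists y.
    exact: (IH2 _ _ _ (esub_upd x H uy) Ew).
  case Em: (omapM _ _) => [mm|] /=; last first.
    have [u /mlP[w _ [u' Eu _]]] := proj1 (omapM_None _ _) Em.
    by rewrite Eu.
  exists (PColl mm) => //; apply/lsub_collP => u'.
  move=> /(omapM_memr _ Em)[u /mlP[w wl [u'' -> u''w]] [<-]].
  by exists w.
- move=> e1 IH1 e2 IH2 e3 IH3 e4 IH4 s s' v H.
  case E1: (peval e1 s') => [[b1|? ?|?]|] //; case E2: (peval e2 s') => [[b2|? ?|?]|] //.
  have [[a1|? ?|?] -> // ab1] := IH1 _ _ _ H E1.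
  have [[a2|? ?|?] -> // ab2] := IH2 _ _ _ H E2.
  rewrite (R_bij ab1 ab2); case: eqP => _; [exact: IH3|exact: IH4].
- move=> e1 IH1 k e2 IH2 e3 IH3 s s' v H.
  case E1: (peval e1 s') => [v1|] //.
  have [u1 -> /(pkind_lsub k) ->] := IH1 _ _ _ H E1.
  by case: pkind; [exact: IH2|exact: IH3].
Qed.

End Sub.

(** * Joins of trees, demands on variables, and cutting an environment down to its demands *)

Section SmallModel.
Variable A : countType.
Implicit Types (u v w : pre A) (s : penv (pre A)).

Local Notation sub := (lsub (@eq_op A)).
Local Notation "s <=e s'" := (esub (@eq_op A) s s') (at level 70).

Lemma sub_refl u : sub u u.
Proof.
elim/pre_ind': u => [a|u v Hu Hv|l /pre_allP Hl] /=; rewrite ?eqxx ?Hu ?Hv //.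
by apply/allP=> x xl; apply/hasP; exists x => //; exact: Hl.
Qed.

Lemma sub_trans v u w : sub u v -> sub v w -> sub u w.
Proof.
elim/pre_ind': u v w => [a|u1 u2 IH1 IH2|l /pre_allP IH] [b|v1 v2|m] [c|w1 w2|n] //=.
- by move=> /eqP->.
- by move=> /andP[/IH1 H1 /IH2 H2] /andP[/H1 -> /H2 ->].
- move=> /allP lm /allP mn; apply/allP => x xl.
  have /hasP[y /mn/hasP[z zn yz] xy] := lm _ xl.
  by apply/hasP; exists z => //; exact: IH yz.
Qed.

Lemma eq_bij (a a' b b' : A) : a == b -> a' == b' -> (a == a') = (b == b').
Proof. by move=> /eqP-> /eqP->. Qed.

Fixpoint psize u : nat :=
  match u with
  | PAtom _ => 1
  | PPair v w => psize v + psize w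
  | PColl l => (sumn (map psize l)).+1
  end.

(** Only nested pairs count. Sets add nothing to the depth of their elements, so the values of a
    fixed type have bounded depth although their size is unbounded. *)
Fixpoint pdepth u : nat :=
  match u with
  | PAtom _ => 0
  | PPair v w => (maxn (pdepth v) (pdepth w)).+1
  | PColl l => foldr maxn 0 (map pdepth l)
  end.

Fixpoint pmin u : pre A :=
  match u with
  | PAtom a => PAtom a
  | PPair v w => PPair (pmin v) (pmin w)
  | PColl _ => PColl [::]
  end.

(** A least upper bound for trees with a common upper bound, which agree on atoms and pairs outside
    sets; elsewhere the result is arbitrary. *)
Fixpoint pjoin u v : pre A :=
  match u, v with
  | PPair u1 u2, PPair v1 v2 => PPair (pjoin u1 v1) (pjoin u2 v2)
  | PColl l, PColl m => PColl (l ++ m)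
  | _, _ => u
  end.

Fixpoint patoms u : seq A :=
  match u with
  | PAtom a => [:: a]
  | PPair v w => patoms v ++ patoms w
  | PColl l => flatten (map patoms l)
  end.

Lemma psize_gt0 u : 0 < psize u.
Proof. by elim/pre_ind': u => //= u v; lia. Qed.

Lemma psize_pmin u : psize (pmin u) <= 2 ^ pdepth u.
Proof.
elim/pre_ind': u => [a|u v Hu Hv|l _] //=; last by rewrite expn_gt0.
rewrite expnS mul2n -addnn leq_add //.
  by rewrite (leq_trans Hu) // leq_exp2l // leq_maxl.
by rewrite (leq_trans Hv) // leq_exp2l // leq_maxr.
Qed.

Lemma size_patoms u : size (patoms u) <= psize u.
Proof.
elim/pre_ind': u => [a|u v Hu Hv|l /pre_allP Hl] //=.
  by rewrite size_cat leq_add.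
rewrite leqW // size_flatten /shape -map_comp.
elim: l Hl => //= u l IH Hl; rewrite leq_add ?Hl ?mem_head // IH // => v vl.
by rewrite Hl // inE vl orbT.
Qed.

Lemma pmin_sub u : sub (pmin u) u.
Proof. by elim/pre_ind': u => [a|u v /= -> ->|l _] //=. Qed.

Lemma sub_pjoinl u v w : sub u w -> sub v w -> sub u (pjoin u v).
Proof.
elim/pre_ind': u v w => [a|u1 u2 IH1 IH2|l _] [b|v1 v2|m] [c|w1 w2|n] //=.
  by move=> /andP[u1w u2w] /andP[v1w v2w]; rewrite (IH1 _ _ u1w) ?(IH2 _ _ u2w).
move=> _ _; apply/allP=> x xl; apply/hasP; exists x; last exact: sub_refl.
by rewrite mem_cat xl.
Qed.

Lemma sub_pjoinr u v w : sub u w -> sub v w -> sub v (pjoin u v).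
Proof.
elim/pre_ind': u v w => [a|u1 u2 IH1 IH2|l _] [b|v1 v2|m] [c|w1 w2|n] //=.
- by move=> /eqP-> /eqP->.
- by move=> /andP[u1w u2w] /andP[v1w v2w]; rewrite (IH1 _ w1) ?(IH2 _ w2).
move=> _ _; apply/allP=> x xl; apply/hasP; exists x; last exact: sub_refl.
by rewrite mem_cat xl orbT.
Qed.

Lemma pjoin_sub u v w : sub u w -> sub v w -> sub (pjoin u v) w.
Proof.
elim/pre_ind': u v w => [a|u1 u2 IH1 IH2|l _] [b|v1 v2|m] [c|w1 w2|n] //=.
  by move=> /andP[u1w u2w] /andP[v1w v2w]; rewrite IH1 ?IH2.
by rewrite all_cat => -> ->.
Qed.

Lemma psize_pjoin u v : psize (pjoin u v) <= psize u + psize v.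
Proof.
elim/pre_ind': u v => [a|u1 u2 IH1 IH2|l _] [b|v1 v2|m] /=; try lia.
  by have := IH1 v1; have := IH2 v2; lia.
by rewrite map_cat sumn_cat; lia.
Qed.

Lemma patoms_pjoin u v : {subset patoms (pjoin u v) <= patoms u ++ patoms v}.
Proof.
elim/pre_ind': u v => [a|u1 u2 IH1 IH2|l _] [b|v1 v2|m] x /=;
  rewrite ?map_cat ?flatten_cat ?mem_cat ?inE; try by move=> ->.
by case/orP=> [/IH1|/IH2]; rewrite mem_cat => /orP[] ->; rewrite ?orbT.
Qed.

Lemma pdepth_coll d l : (pdepth (PColl l) <= d) = all (fun u => pdepth u <= d) l.
Proof. by elim: l => //= u l <-; rewrite geq_max. Qed.

Implicit Types D : seq (var * pre A).

(** Demands are the lower bounds traced backwards through an expression. Concatenation is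
    conjunction, so costs add up. *)
Definition demand D s : bool :=
  all (fun p => if s p.1 is Some v then sub p.2 v else false) D.

Definition dsize D : nat := sumn [seq psize p.2 | p <- D].

Lemma dsize_cat D D' : dsize (D ++ D') = dsize D + dsize D'.
Proof. by rewrite /dsize map_cat sumn_cat. Qed.

(** Starting from [pmin v] gives the result the shape of [v] even when no demand mentions [x]. *)
Definition cut D x v : pre A := foldr pjoin (pmin v) [seq p.2 | p <- D & p.1 == x].

Lemma cutP D x v s : s x = Some v -> demand D s ->
  sub (cut D x v) v /\ {in D, forall p, p.1 = x -> sub p.2 (cut D x v)}.
Proof.
rewrite /cut => sx; elim: D => [|[y w] D IH] /=.
  by split=> //; exact: pmin_sub.
move=> /andP[Dy /IH [IH1 IH2]]; case: eqP => /= [eq_yx|ne_yx]; last first.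
  by split=> // p; rewrite inE => /predU1P[->|/IH2].
move: Dy; rewrite eq_yx sx => wv; split; first exact: pjoin_sub.
move=> p; rewrite inE => /predU1P[->|/IH2 H /H pc]; first by move=> _; exact: sub_pjoinl IH1.
by apply: sub_trans pc _; exact: sub_pjoinr IH1.
Qed.

Lemma psize_cut D x v : psize (cut D x v) <= dsize D + psize (pmin v).
Proof.
rewrite /cut /dsize; elim: D => //= -[y w] D IH; case: eqP => _ /=; last first.
  by apply: leq_trans IH _; rewrite -addnA leq_addl.
by apply: leq_trans (psize_pjoin _ _) _; rewrite -addnA leq_add2l.
Qed.

Lemma patoms_cut D x v a : a \in patoms (cut D x v) ->
  (a \in patoms (pmin v)) || has (fun p => a \in patoms p.2) D.
Proof.
rewrite /cut; elim: D => [|[y w] D IH] /=; first by rewrite orbF.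
case: eqP => _ /=; last by move=> /IH /orP[] ->; rewrite ?orbT.
by move=> /patoms_pjoin; rewrite mem_cat => /orP[->|/IH /orP[]->]; rewrite ?orbT.
Qed.

Definition cut_env D s : penv (pre A) := fun x => omap (cut D x) (s x).

Lemma cut_envP D s : demand D s -> cut_env D s <=e s /\ demand D (cut_env D s).
Proof.
move=> Ds; split=> [x|]; rewrite /cut_env.
  by case sx: (s x) => [v|] //=; have [] := cutP sx Ds.
apply/allP=> p pD; have := allP Ds p pD; case sx: (s _) => [v|] //= _.
by have [_ ->] := cutP sx Ds.
Qed.

Fixpoint esize (e : expr) : nat :=
  match e with
  | EVar _ | EEmpty => 1
  | EPair e1 e2 | EUnion e1 e2 | EFor e1 _ e2 => (esize e1 + esize e2).+1
  | EFst e1 | ESnd e1 | ESing e1 | EFlatten e1 => (esize e1).+1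
  | EIfEq e1 e2 e3 e4 => (esize e1 + esize e2 + esize e3 + esize e4).+1
  | EIfKind e1 _ e2 e3 => (esize e1 + esize e2 + esize e3).+1
  end.

Lemma esize_gt0 e : 0 < esize e.
Proof. by case: e. Qed.

Definition bounded d s := forall x v, s x = Some v -> pdepth v <= d.

Lemma bounded_upd d d' x v s : bounded d s -> d <= d' -> pdepth v <= d' -> bounded d' (upd x v s).
Proof.
move=> H dd' vd y w; rewrite /upd; case: eqP => [_ [<-]|_ /H] //.
by move/leq_trans; apply.
Qed.

(** Only pairing adds depth, one level each time. The variable of a comprehension takes values of
    depth up to [d + esize e1], so the bounds add up over nested comprehensions. *)
Lemma pdepth_peval e d s v :
  bounded d s -> peval e s = Some v -> pdepth v <= d + esize e.
Proof.
elim: e d s v => /=.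
- by move=> x d s v H /H; lia.
- move=> e1 IH1 e2 IH2 d s v H.
  case E1: (peval e1 s) => [v1|] //; case E2: (peval e2 s) => [v2|] // [<-] /=.
  by have := IH1 _ _ _ H E1; have := IH2 _ _ _ H E2; lia.
- move=> e1 IH1 d s v H; case E1: (peval e1 s) => [[a|v1 v2|l]|] // [<-].
  by have := IH1 _ _ _ H E1 => /=; lia.
- move=> e1 IH1 d s v H; case E1: (peval e1 s) => [[a|v1 v2|l]|] // [<-].
  by have := IH1 _ _ _ H E1 => /=; lia.
- by move=> d s v _ [<-].
- move=> e1 IH1 d s v H; case E1: (peval e1 s) => [v1|] // [<-] /=.
  by have := IH1 _ _ _ H E1; lia.
- move=> e1 IH1 e2 IH2 d s v H.
  case E1: (peval e1 s) => [[a|? ?|l1]|] //; case E2: (peval e2 s) => [[a|? ?|l2]|] // [<-].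
  have := IH1 _ _ _ H E1; have := IH2 _ _ _ H E2.
  rewrite !pdepth_coll all_cat => /allP H2 /allP H1.
  by apply/andP; split; apply/allP => u; [move/H1|move/H2]; lia.
- move=> e1 IH1 d s v H.
  case E1: (peval e1 s) => [[a|? ?|l]|] //; case El: (omapM _ _) => [ll|] //= [<-].
  have := IH1 _ _ _ H E1; rewrite !pdepth_coll => /allP H1.
  apply/allP=> u /flattenP[c /(omapM_memr _ El)[[|? ?|n] // /H1 nd [Ec]] uc].
  rewrite -{}Ec in uc; move: nd.
  by rewrite pdepth_coll => /allP /(_ _ uc); lia.
- move=> e2 IH2 x e1 IH1 d s v H.
  case E1: (peval e1 s) => [[a|? ?|l]|] //; case El: (omapM _ _) => [ll|] //= [<-].
  have := IH1 _ _ _ H E1; rewrite !pdepth_coll => /allP H1.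
  apply/allP=> u /(omapM_memr _ El)[w /H1 wd Eu].
  have := IH2 (d + esize e1) _ _ (bounded_upd H _ wd) Eu; lia.
- move=> e1 IH1 e2 IH2 e3 IH3 e4 IH4 d s v H.
  case E1: (peval e1 s) => [[b1|? ?|?]|] //; case E2: (peval e2 s) => [[b2|? ?|?]|] //.
  by case: eqP => _ E; [have := IH3 _ _ _ H E|have := IH4 _ _ _ H E]; lia.
- move=> e1 IH1 k e2 IH2 e3 IH3 d s v H.
  case E1: (peval e1 s) => [v1|] //.
  by case: pkind => E; [have := IH2 _ _ _ H E|have := IH3 _ _ _ H E]; lia.
Qed.

Lemma peval_sub e s s' v : s' <=e s -> peval e s = Some v ->
  exists2 u, peval e s' = Some u & sub u v.
Proof. by apply: peval_lsub; exact: eq_bij. Qed.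

Lemma esub_refl s : s <=e s.
Proof. by move=> x; case: (s x) => // u; exact: sub_refl. Qed.

(** That [s] meets [D] keeps the condition from being vacuous. Above [s] evaluation might fail,
    hence the restriction to [s' <=e s]. *)
Definition ensures D s (P : penv (pre A) -> Prop) : Prop :=
  demand D s /\ forall s', s' <=e s -> demand D s' -> P s'.

(** This additivity is the reason for measuring demands in multiples of [psize w]. *)
Lemma ensures_gather s c (P : penv (pre A) -> pre A -> Prop) ws :
  (forall w, w \in ws ->
    exists2 D, dsize D <= psize w * c & ensures D s (fun s' => P s' w)) ->
  exists2 D, dsize D <= sumn (map psize ws) * c
    & ensures D s (fun s' => forall w, w \in ws -> P s' w).
Proof.
elim: ws => [|w ws IH] H; first by exists [::].
have [D szD [Ds DP]] := H w (mem_head _ _).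
have [|D' szD' [D's D'P]] := IH; first by move=> z zs; apply: H; rewrite inE zs orbT.
exists (D ++ D'); first by rewrite dsize_cat /=; lia.
split=> [|s' s's]; first by rewrite /demand all_cat; apply/andP.
rewrite /demand all_cat => /andP[Ds' D's'] z; rewrite inE => /predU1P[->|]; first exact: DP.
by apply: D'P.
Qed.

Definition reaches e w (s : penv (pre A)) : Prop :=
  exists2 v, peval e s = Some v & sub w v.

Definition reaches_elt e w (s : penv (pre A)) : Prop :=
  exists2 l, peval e s = Some (PColl l) & exists2 v, v \in l & sub w v.

(** Lying above a set can be arranged one element at a time, so only single elements have to be
    traced. The empty set asks just that evaluation succeed, which shrinking preserves. *)
Lemma reaches_coll e s l c w :
  peval e s = Some (PColl l) ->
  (forall w v, v \in l -> sub w v ->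
     exists2 D, dsize D <= psize w * c & ensures D s (reaches_elt e w)) ->
  sub w (PColl l) -> exists2 D, dsize D <= psize w * c & ensures D s (reaches e w).
Proof.
case: w => // ws El H /lsub_collP ws_l.
have [|D szD [Ds DP]] := @ensures_gather s c (fun s' w => reaches_elt e w s') ws.
  by move=> w /ws_l[v]; exact: H.
exists D; first by apply: leq_trans szD _; rewrite leq_mul2r leqnSn orbT.
split=> // s' s's Ds'.
have [[|? ?|m] // Em _] := peval_sub s's El.
exists (PColl m) => //; apply/lsub_collP => w /(DP _ s's Ds')[l' El' [v vl' wv]].
by move: El'; rewrite Em => -[->]; exists v.
Qed.

Lemma reaches_sing e w s : reaches e (PColl [:: w]) s -> reaches_elt e w s.
Proof.
case=> -[|? ?|l] El //= /andP[/hasP[v vl wv] _].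
by exists l => //; exists v.
Qed.

(** * Tracing a part of a result back to demands on the environment *)

Section Provenance.
Variable H : nat.
Notation B := H.+2.

(* [H] bounds the size of [pmin v] for all values [v] met during the evaluation,
since these have depth at most [d + esize e]. *)
Definition provenance e : Prop := forall d s v w,
  bounded d s -> 2 ^ (d + esize e) <= H -> peval e s = Some v -> sub w v ->
  exists2 D, dsize D <= psize w * B ^ esize e & ensures D s (reaches e w).

Lemma pow_weaken d m n : m <= n -> 2 ^ (d + n) <= H -> 2 ^ (d + m) <= H.
Proof. by move=> mn; apply: leq_trans; rewrite leq_exp2l // leq_add2l. Qed.

Lemma B_le m n : m <= n -> B ^ m <= B ^ n.
Proof. by move=> mn; rewrite leq_exp2l. Qed.

Lemma B_ge n : 0 < n -> B <= B ^ n.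
Proof. by move=> n0; rewrite -{1}[B]expn1 leq_exp2l. Qed.

Lemma H_gt0 n : 2 ^ n <= H -> 0 < H.
Proof. by apply: leq_trans; rewrite expn_gt0. Qed.

(* The variable [x] is given the least value meeting the demands on it, which
then has to be below some element of the collection. *)
Lemma for_provenance e1 e2 x d s l v n D2 :
  provenance e1 -> bounded d s -> 2 ^ (d + (esize e1 + esize e2)) <= H ->
  peval e1 s = Some (PColl l) -> v \in l -> 0 < n ->
  dsize D2 <= n * B ^ esize e2 -> demand D2 (upd x v s) ->
  exists2 D, dsize D <= n * B ^ (esize e1 + esize e2).+1 &
    ensures D s (fun s' => exists2 l', peval e1 s' = Some (PColl l') &
      exists v' v'', [/\ v'' \in l', sub v' v'', sub v' v & demand D2 (upd x v' s')]).
Proof.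
move=> prov1 ds dH El vl n0 szD2 D2v.
have upd_x : upd x v s x = Some v by rewrite /upd eqxx.
have [cut_v cut_D2] := cutP upd_x D2v; set v' := cut D2 x v in cut_v cut_D2.
(* The demands on [x] cost at most [dsize D2], the skeleton of [v] at most [H]. *)
have szv' : psize v' <= n * B ^ esize e2 + H.
  apply: leq_trans (psize_cut _ _ _) _; apply: leq_add => //.
  apply: leq_trans (psize_pmin _) _; apply: leq_trans dH; rewrite leq_exp2l //.
  have := pdepth_peval ds El; rewrite pdepth_coll => /allP/(_ _ vl); lia.
have [||D1 szD1 [D1s D1P]] := prov1 d s _ (PColl [:: v']) ds _ El.
- by apply: pow_weaken dH; rewrite leq_addr.
- by apply/lsub_collP => u; rewrite inE => /eqP->; exists v.
(* The demands on [x] are absorbed into [v'], which is now a demand on [e1]; those on other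
   variables are passed on. *)
exists (D1 ++ [seq p <- D2 | p.1 != x]).
  have szF : dsize [seq p <- D2 | p.1 != x] <= n * B ^ esize e2.
    apply: leq_trans szD2; rewrite /dsize; elim: (D2) => //= p D' IH.
    by case: ifP => _ /=; lia.
  rewrite dsize_cat; apply: leq_trans (leq_add szD1 szF) _ => /=.
  rewrite expnS expnD.
  have b1 := B_ge (esize_gt0 e1); have b2 := B_ge (esize_gt0 e2).
  have H0 := H_gt0 dH.
  move: (B ^ esize e1) (B ^ esize e2) b1 b2 szv' => X Y XB YB szv'.
  (* The left side is at most [n * Y + H + 1], and [H + 2 <= Y]. *)
  have szv : (psize v' + 0).+1 <= 2 * (n * Y) by nia.
  have : (psize v' + 0).+1 * X <= 2 * (n * Y) * X by rewrite leq_mul2r szv orbT.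
  have : n * Y <= n * Y * X by rewrite leq_pmulr //; lia.
  (* Two parts come from [e1] and one from the remaining demands; [3 <= B] because [H] is
     positive. *)
  have : 3 * (n * Y * X) <= n * (B * (X * Y)) by nia.
  lia.
split=> [|s' s's].
  rewrite /demand all_cat; apply/andP; split=> //; apply/allP => p.
  rewrite mem_filter => /andP[px /(allP D2v)].
  by rewrite /upd (negbTE px).
rewrite /demand all_cat => /andP[D1s' /allP Fs'].
have [l' El' [v'' v''l' v'v'']] := reaches_sing (D1P s' s's D1s').
exists l' => //; exists v', v''; split=> //; apply/allP => p pD2; rewrite /upd.
by case: eqP => [/cut_D2 ->|/eqP px] //; apply: Fs'; rewrite mem_filter px.
Qed.

Lemma ensures_weaken D s (P Q : penv (pre A) -> Prop) :
  (forall s', s' <=e s -> P s' -> Q s') -> ensures D s P -> ensures D s Q.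
Proof. by move=> PQ [Ds DP]; split=> // s' s's Ds'; apply: PQ => //; exact: DP. Qed.

Lemma ensures_cat D D' s (P Q : penv (pre A) -> Prop) :
  ensures D s P -> ensures D' s Q -> ensures (D ++ D') s (fun s' => P s' /\ Q s').
Proof.
move=> [Ds DP] [D's D'Q]; split=> [|s' s's]; rewrite /demand all_cat.
  by apply/andP.
by case/andP=> Ds' D's'; split; [exact: DP|exact: D'Q].
Qed.

(** Every case turns [w] into demands on subexpressions that are larger by at most one factor [B];
    induction supplies the remaining power. Conditions contribute no demands, because shrinking
    cannot change the outcome of a test. *)
Lemma peval_provenance e : provenance e.
Proof.
rewrite /provenance; elim: e => /=.
- move=> x d s v w _ _ sx wv; exists [:: (x, w)].
    by rewrite /dsize /= expn1; have := psize_gt0 w; nia.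
  split=> [|s' s's]; rewrite /demand /= ?sx ?wv //.
  by case s'x: (s' x) => [v'|] //; rewrite andbT; exists v'; rewrite //= s'x.
- move=> e1 IH1 e2 IH2 d s v w ds dH.
  case E1: (peval e1 s) => [v1|] //; case E2: (peval e2 s) => [v2|] // [<-].
  case: w => // w1 w2 /= /andP[wv1 wv2].
  have [|D1 sz1 ens1] := IH1 _ _ _ _ ds _ E1 wv1; first by apply: pow_weaken dH; lia.
  have [|D2 sz2 ens2] := IH2 _ _ _ _ ds _ E2 wv2; first by apply: pow_weaken dH; lia.
  exists (D1 ++ D2).
    rewrite dsize_cat mulnDl leq_add //.
      by apply: leq_trans sz1 _; rewrite leq_mul2l B_le ?orbT //; lia.
    by apply: leq_trans sz2 _; rewrite leq_mul2l B_le ?orbT //; lia.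
  apply: ensures_weaken (ensures_cat ens1 ens2) => s' _ [[u1 Eu1 wu1] [u2 Eu2 wu2]].
  by exists (PPair u1 u2); rewrite /= ?Eu1 ?Eu2 ?wu1.
- move=> e1 IH1 d s v w ds dH.
  case E1: (peval e1 s) => [[a|v1 v2|l]|] // [<-] wv1.
  (* A demand on a pair has to fill both components. The least filler is [pmin v2], of size at most
     [H], and [psize w + H <= psize w * B]. *)
  have [||D sz ens] := IH1 _ _ _ (PPair w (pmin v2)) ds _ E1.
  + by apply: pow_weaken dH; lia.
  + by rewrite /= wv1 pmin_sub.
  exists D.
    apply: leq_trans sz _; rewrite expnS mulnA leq_mul2r; apply/orP; right => /=.
    have szm : psize (pmin v2) <= H.
      apply: leq_trans (psize_pmin _) _; apply: leq_trans dH; rewrite leq_exp2l //.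
      by have := pdepth_peval ds E1 => /=; lia.
    by have := psize_gt0 w; nia.
  apply: ensures_weaken ens => s' _ [[|u1 u2|] // Eu /= /andP[wu1 _]].
  by exists u1; rewrite /= ?Eu.
- move=> e1 IH1 d s v w ds dH.
  case E1: (peval e1 s) => [[a|v1 v2|l]|] // [<-] wv2.
  have [||D sz ens] := IH1 _ _ _ (PPair (pmin v1) w) ds _ E1.
  + by apply: pow_weaken dH; lia.
  + by rewrite /= wv2 pmin_sub.
  exists D.
    apply: leq_trans sz _; rewrite expnS mulnA leq_mul2r; apply/orP; right => /=.
    have szm : psize (pmin v1) <= H.
      apply: leq_trans (psize_pmin _) _; apply: leq_trans dH; rewrite leq_exp2l //.
      by have := pdepth_peval ds E1 => /=; lia.
    by have := psize_gt0 w; nia.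
  apply: ensures_weaken ens => s' _ [[|u1 u2|] // Eu /= /andP[_ wu2]].
  by exists u2; rewrite /= ?Eu.
- move=> d s v w _ _ [<-] wv; exists [::] => //.
  by split=> // s' _ _; exists (PColl [::]).
- move=> e1 IH1 d s v w ds dH.
  case E1: (peval e1 s) => [v1|] // [<-].
  apply: reaches_coll; first by rewrite /= E1.
  move=> {}w u; rewrite inE => /eqP-> wv1.
  have [|D sz ens] := IH1 _ _ _ _ ds _ E1 wv1; first by apply: pow_weaken dH; lia.
  exists D; first by apply: leq_trans sz _; rewrite leq_mul2l B_le ?orbT.
  apply: ensures_weaken ens => s' _ [u1 Eu wu1].
  by exists [:: u1]; rewrite /= ?Eu //; exists u1; rewrite ?mem_head.
- move=> e1 IH1 e2 IH2 d s v w ds dH.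
  case E1: (peval e1 s) => [[a|? ?|l1]|] //; case E2: (peval e2 s) => [[a|? ?|l2]|] // [<-].
  apply: reaches_coll; first by rewrite /= E1 E2.
  have bnd (n m : nat) (u : pre A) : n < m -> psize (PColl [:: u]) * B ^ n <= psize u * B ^ m.
    move=> nm; apply: (@leq_trans (psize u * B ^ n.+1)); last by rewrite leq_mul2l B_le ?orbT.
    by rewrite expnS mulnA leq_mul2r /=; have := psize_gt0 u; nia.
  move=> {}w u; rewrite mem_cat => /orP[ul|ul] wu.
    have [||D sz ens] := IH1 _ _ _ (PColl [:: w]) ds _ E1.
    + by apply: pow_weaken dH; lia.
    + by rewrite /= andbT; apply/hasP; exists u.
    exists D; first by apply: leq_trans sz (bnd _ _ _ _); lia.
    apply: ensures_weaken ens => s' s's /reaches_sing [m Em [z zm wz]].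
    (* The other operand only has to remain a set, which it does below [s]. *)
    have [[|? ?|m2] // Em2 _] := peval_sub s's E2.
    exists (m ++ m2); first by rewrite /= Em Em2.
    by exists z; rewrite // mem_cat zm.
  have [||D sz ens] := IH2 _ _ _ (PColl [:: w]) ds _ E2.
  + by apply: pow_weaken dH; lia.
  + by rewrite /= andbT; apply/hasP; exists u.
  exists D; first by apply: leq_trans sz (bnd _ _ _ _); lia.
  apply: ensures_weaken ens => s' s's /reaches_sing [m Em [z zm wz]].
  have [[|? ?|m2] // Em2 _] := peval_sub s's E1.
  exists (m2 ++ m); first by rewrite /= Em Em2.
  by exists z; rewrite // mem_cat zm orbT.
- move=> e1 IH1 d s v w ds dH.
  case E1: (peval e1 s) => [[a|? ?|l]|] //; case El: (omapM _ _) => [ll|] //= [<-].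
  have Ee : peval (EFlatten e1) s = Some (PColl (flatten ll)) by rewrite /= E1 El.
  apply: reaches_coll; first by [].
  move=> {}w u /flattenP[c /(omapM_memr _ El)[[|? ?|n] // nl [Ec]] uc] wu.
  rewrite -{}Ec in uc.
  (* The nested singletons ask for an element above [w] inside some member set. *)
  have [||D sz ens] := IH1 _ _ _ (PColl [:: PColl [:: w]]) ds _ E1.
  + by apply: pow_weaken dH; lia.
  + by rewrite /= andbT; apply/hasP; exists (PColl n) => //=; rewrite andbT; apply/hasP; exists u.
  exists D.
    apply: leq_trans sz _; rewrite expnS mulnA leq_mul2r /=.
    by have := psize_gt0 w; have := H_gt0 dH; nia.
  apply: ensures_weaken ens => s' s's /reaches_sing [m Em [[|? ?|z] // zm /= /andP[/hasP[y yz wy] _]]].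
  have [[|? ?|m2] // Em2 _] := peval_sub s's Ee.
  exists m2 => //; exists y => //; move: Em2; rewrite /= Em.
  case Emm: (omapM _ _) => [mm|] //= [<-].
  by apply/flattenP; exists z => //; apply/(omapM_memr _ Emm); exists (PColl z).
- move=> e2 IH2 x e1 IH1 d s v w ds dH.
  case E1: (peval e1 s) => [[a|? ?|l]|] //; case El: (omapM _ _) => [ll|] //= [<-].
  have Ee : peval (EFor e2 x e1) s = Some (PColl ll) by rewrite /= E1 El.
  apply: reaches_coll; first by [].
  move=> {}w u /(omapM_memr _ El)[z zl Eu] wu.
  have zd : pdepth z <= d + esize e1.
    by have := pdepth_peval ds E1; rewrite pdepth_coll => /allP/(_ _ zl).
  have [||D2 sz2 [D2z D2P]] := IH2 (d + esize e1) _ _ _ (bounded_upd ds _ zd) _ Eu wu.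
  + by lia.
  + by move: dH; apply: leq_trans; rewrite leq_exp2l //; lia.
  have [|D sz ens] := for_provenance (e2 := e2) IH1 ds _ E1 zl (psize_gt0 w) sz2 D2z.
    by apply: pow_weaken dH; lia.
  exists D; first by move: sz; rewrite [esize e1 + _]addnC.
  apply: ensures_weaken ens => s' s's [l' El' [v' [v'' [v''l' v'v'' v'z D2v']]]].
  have [|w' Ew' ww'] := D2P (upd x v' s') _ D2v'; first exact: esub_upd.
  have [[|? ?|m2] // Em2 _] := peval_sub s's Ee.
  exists m2 => //; move: Em2; rewrite /= El'.
  case Emm: (omapM _ _) => [mm|] //= [<-].
  have [y Ey] := omapM_mem Emm v''l'.
  exists y; first by apply/(omapM_memr _ Emm); exists v''.
  (* [D2P] speaks of [x] bound to [v'], while the collection contains some [v''] above it;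
     monotonicity carries [w] over to the result at [v'']. *)
  have [y' Ey' y'y] := peval_sub (esub_upd x (esub_refl s') v'v'') Ey.
  by apply: sub_trans y'y; move: Ey'; rewrite Ew' => -[<-].
- move=> e1 IH1 e2 IH2 e3 IH3 e4 IH4 d s v w ds dH.
  case E1: (peval e1 s) => [[b1|? ?|?]|] //; case E2: (peval e2 s) => [[b2|? ?|?]|] //.
  have test s' : s' <=e s -> peval e1 s' = Some (PAtom b1) /\ peval e2 s' = Some (PAtom b2).
    move=> s's; have [[a1|? ?|?] // -> /= /eqP->] := peval_sub s's E1.
    by have [[a2|? ?|?] // -> /= /eqP->] := peval_sub s's E2.
  case: (boolP (b1 == b2)) => b12 E wv.
    have [|D sz ens] := IH3 _ _ _ _ ds _ E wv; first by apply: pow_weaken dH; lia.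
    exists D; first by apply: leq_trans sz _; rewrite leq_mul2l B_le ?orbT //; lia.
    apply: ensures_weaken ens => s' /test[E1' E2'] [v' Ev' wv'].
    by exists v'; rewrite //= E1' E2' b12.
  have [|D sz ens] := IH4 _ _ _ _ ds _ E wv; first by apply: pow_weaken dH; lia.
  exists D; first by apply: leq_trans sz _; rewrite leq_mul2l B_le ?orbT //; lia.
  apply: ensures_weaken ens => s' /test[E1' E2'] [v' Ev' wv'].
  by exists v'; rewrite //= E1' E2' (negbTE b12).
- move=> e1 IH1 k e2 IH2 e3 IH3 d s v w ds dH.
  case E1: (peval e1 s) => [v1|] //.
  have test s' : s' <=e s -> exists2 u, peval e1 s' = Some u & pkind k u = pkind k v1.
    by move=> s's; have [u -> uv1] := peval_sub s's E1; exists u => //; exact: pkind_lsub uv1.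
  case: (boolP (pkind k v1)) => kv1 E wv.
    have [|D sz ens] := IH2 _ _ _ _ ds _ E wv; first by apply: pow_weaken dH; lia.
    exists D; first by apply: leq_trans sz _; rewrite leq_mul2l B_le ?orbT //; lia.
    apply: ensures_weaken ens => s' /test[u E1' ku] [v' Ev' wv'].
    by exists v'; rewrite //= E1' ku kv1.
  have [|D sz ens] := IH3 _ _ _ _ ds _ E wv; first by apply: pow_weaken dH; lia.
  exists D; first by apply: leq_trans sz _; rewrite leq_mul2l B_le ?orbT //; lia.
  apply: ensures_weaken ens => s' /test[u E1' ku] [v' Ev' wv'].
  by exists v'; rewrite //= E1' ku (negbTE kv1).
Qed.

End Provenance.

End SmallModel.

(** * Small counterexamples and maximal environments *)

Section Counterexample.
Variable A : countType.
Implicit Types (u v w : pre A) (s : penv (pre A)).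
Local Notation sub := (lsub (@eq_op A)).
Local Notation "s <=e s'" := (esub (@eq_op A) s s') (at level 70).

Lemma ensures_le H d m n s (P Q : penv (pre A) -> Prop) :
  (2 ^ (d + m) <= H -> exists2 D, dsize D <= H.+2 ^ m & ensures D s P) ->
  2 ^ (d + n) <= H -> m <= n -> (forall s', s' <=e s -> P s' -> Q s') ->
  exists2 D, dsize D <= H.+2 ^ n & ensures D s Q.
Proof.
move=> ex dH mn PQ; have [|D szD ens] := ex; first exact: pow_weaken dH.
exists D; first exact: leq_trans szD (B_le _ mn).
exact: ensures_weaken PQ ens.
Qed.

(** A value of the wrong shape keeps it under shrinking and costs nothing. Demands arise in two
    cases, a non-set inside a flattened set and a comprehension whose body fails at one element:
    provenance keeps a suitable element in the collection. *)
Lemma peval_undefined H e d s :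
  bounded d s -> 2 ^ (d + esize e) <= H -> peval e s = None ->
  exists2 D, dsize D <= H.+2 ^ esize e & ensures D s (fun s' => peval e s' = None).
Proof.
elim: e d s => /=.
- move=> x d s _ _ sx; exists [::] => //; split=> // s' /(_ x).
  by rewrite sx; case: (s' x).
- move=> e1 IH1 e2 IH2 d s ds dH.
  case E1: (peval e1 s) => [v1|]; last first.
    move=> _; apply: ensures_le (fun dH' => IH1 _ _ ds dH' E1) dH _ _; first by lia.
    by move=> s' _ ->.
  case E2: (peval e2 s) => [v2|] // _.
  apply: ensures_le (fun dH' => IH2 _ _ ds dH' E2) dH _ _; first by lia.
  by move=> s' _ ->; case: peval.
- move=> e1 IH1 d s ds dH.
  case E1: (peval e1 s) => [v1|]; last first.
    move=> _; apply: ensures_le (fun dH' => IH1 _ _ ds dH' E1) dH _ _; first by lia.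
    by move=> s' _ ->.
  move=> Ev; exists [::] => //; split=> // s' s's _.
  have [u -> uv1] := peval_sub s's E1.
  by case: v1 u Ev uv1 {E1} => [?|? ?|?] [?|? ?|?].
- move=> e1 IH1 d s ds dH.
  case E1: (peval e1 s) => [v1|]; last first.
    move=> _; apply: ensures_le (fun dH' => IH1 _ _ ds dH' E1) dH _ _; first by lia.
    by move=> s' _ ->.
  move=> Ev; exists [::] => //; split=> // s' s's _.
  have [u -> uv1] := peval_sub s's E1.
  by case: v1 u Ev uv1 {E1} => [?|? ?|?] [?|? ?|?].
- by [].
- move=> e1 IH1 d s ds dH.
  case E1: (peval e1 s) => [v1|] // _.
  apply: ensures_le (fun dH' => IH1 _ _ ds dH' E1) dH _ _; first by lia.
  by move=> s' _ ->.
- move=> e1 IH1 e2 IH2 d s ds dH.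
  case E1: (peval e1 s) => [v1|]; last first.
    move=> _; apply: ensures_le (fun dH' => IH1 _ _ ds dH' E1) dH _ _; first by lia.
    by move=> s' _ ->.
  case E2: (peval e2 s) => [v2|]; last first.
    move=> _; apply: ensures_le (fun dH' => IH2 _ _ ds dH' E2) dH _ _; first by lia.
    by move=> s' _ ->; case: peval => // -[].
  move=> Ev; exists [::] => //; split=> // s' s's _.
  have [u1 -> uv1] := peval_sub s's E1; have [u2 -> uv2] := peval_sub s's E2.
  by case: v1 u1 Ev uv1 {E1} => [?|? ?|?] [?|? ?|?] //; case: v2 u2 uv2 {E2} => [?|? ?|?] [?|? ?|?].
- move=> e1 IH1 d s ds dH.
  case E1: (peval e1 s) => [v1|]; last first.
    move=> _; apply: ensures_le (fun dH' => IH1 _ _ ds dH' E1) dH _ _; first by lia.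
    by move=> s' _ ->.
  case: v1 E1 => [a|v1 v2|l] E1 Ev.
  + by exists [::] => //; split=> // s' s's _; have [[?|? ?|?] // ->] := peval_sub s's E1.
  + by exists [::] => //; split=> // s' s's _; have [[?|? ?|?] // ->] := peval_sub s's E1.
  move: Ev; case El: (omapM _ _) => // _; have [v vl nset] := proj1 (omapM_None _ _) El.
  (* Whatever lies above [pmin v] has the shape of [v], hence is not a set. *)
  have [||D sz ens] := @peval_provenance _ H e1 _ _ _ (PColl [:: pmin v]) ds _ E1.
  + by apply: pow_weaken dH; lia.
  + by rewrite /= andbT; apply/hasP; exists v => //; exact: pmin_sub.
  exists D.
    apply: leq_trans sz _; rewrite expnS leq_mul2r; apply/orP; right => /=.
    have : psize (pmin v) <= H; last by lia.
    apply: leq_trans (psize_pmin _) _; apply: leq_trans dH; rewrite leq_exp2l //.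
    by have := pdepth_peval ds E1; rewrite pdepth_coll => /allP/(_ _ vl); lia.
  apply: ensures_weaken ens => s' _ /reaches_sing[m -> [u um vu]].
  case Em: (omapM _ _) => [mm|] //=; have [c] := omapM_mem Em um.
  by case: v u nset vu {vl um sz} => [?|? ?|?] [?|? ?|?].
- move=> e2 IH2 x e1 IH1 d s ds dH.
  case E1: (peval e1 s) => [v1|]; last first.
    move=> _; apply: ensures_le (fun dH' => IH1 _ _ ds dH' E1) dH _ _; first by lia.
    by move=> s' _ ->.
  case: v1 E1 => [a|v1 v2|l] E1 Ev.
  + by exists [::] => //; split=> // s' s's _; have [[?|? ?|?] // ->] := peval_sub s's E1.
  + by exists [::] => //; split=> // s' s's _; have [[?|? ?|?] // ->] := peval_sub s's E1.
  move: Ev; case El: (omapM _ _) => // _; have [v vl Ev] := proj1 (omapM_None _ _) El.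
  have vd : pdepth v <= d + esize e1.
    by have := pdepth_peval ds E1; rewrite pdepth_coll => /allP/(_ _ vl).
  have [||D2 sz2 [D2v D2P]] := IH2 (d + esize e1) _ (bounded_upd ds _ vd) _ Ev.
  + by lia.
  + by move: dH; apply: leq_trans; rewrite leq_exp2l //; lia.
  rewrite -[_ ^ _]mul1n in sz2.
  have [|D sz ens] := for_provenance (@peval_provenance _ H e1) ds _ E1 vl (ltn0Sn 0) sz2 D2v.
    by apply: pow_weaken dH; lia.
  exists D; first by move: sz; rewrite mul1n [esize e1 + _]addnC.
  apply: ensures_weaken ens => s' s's [l' -> [v' [v'' [v''l' v'v'' v'v D2v']]]].
  case Em: (omapM _ _) => [mm|] //; have [y Ey] := omapM_mem Em v''l'.
  (* Were the body defined at [v''], it would be defined at the smaller [v']. *)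
  have [u] := peval_sub (esub_upd x (esub_refl s') v'v'') Ey.
  by rewrite (D2P (upd x v' s') _ D2v') //; exact: esub_upd.
- move=> e1 IH1 e2 IH2 e3 IH3 e4 IH4 d s ds dH.
  case E1: (peval e1 s) => [v1|]; last first.
    move=> _; apply: ensures_le (fun dH' => IH1 _ _ ds dH' E1) dH _ _; first by lia.
    by move=> s' _ ->.
  case E2: (peval e2 s) => [v2|]; last first.
    move=> _; apply: ensures_le (fun dH' => IH2 _ _ ds dH' E2) dH _ _; first by lia.
    by move=> s' _ ->; case: peval => // -[].
  have test s' : s' <=e s -> exists u1 u2,
      [/\ peval e1 s' = Some u1, peval e2 s' = Some u2, sub u1 v1 & sub u2 v2].
    move=> s's; have [u1 E1' uv1] := peval_sub s's E1.
    by have [u2 E2' uv2] := peval_sub s's E2; exists u1, u2.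
  case: v1 E1 test => [b1|? ?|?] E1 test; last 2 first.
  + exists [::] => //; split=> // s' /test[u1 [u2 [-> _ + _]]] _.
    by case: u1.
  + exists [::] => //; split=> // s' /test[u1 [u2 [-> _ + _]]] _.
    by case: u1.
  case: v2 E2 test => [b2|? ?|?] E2 test; last 2 first.
  + exists [::] => //; split=> // s' /test[u1 [u2 [-> -> _ +]]] _.
    by case: u1; case: u2.
  + exists [::] => //; split=> // s' /test[u1 [u2 [-> -> _ +]]] _.
    by case: u1; case: u2.
  case: (boolP (b1 == b2)) => b12 E.
    apply: ensures_le (fun dH' => IH3 _ _ ds dH' E) dH _ _; first by lia.
    move=> s' /test[u1 [u2 [-> ->]]].
    case: u1 => // a1 /= /eqP->; case: u2 => // a2 /= /eqP->.
    by rewrite b12.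
  apply: ensures_le (fun dH' => IH4 _ _ ds dH' E) dH _ _; first by lia.
  move=> s' /test[u1 [u2 [-> ->]]].
  case: u1 => // a1 /= /eqP->; case: u2 => // a2 /= /eqP->.
  by rewrite (negbTE b12).
- move=> e1 IH1 k e2 IH2 e3 IH3 d s ds dH.
  case E1: (peval e1 s) => [v1|]; last first.
    move=> _; apply: ensures_le (fun dH' => IH1 _ _ ds dH' E1) dH _ _; first by lia.
    by move=> s' _ ->.
  have test s' : s' <=e s -> exists2 u, peval e1 s' = Some u & pkind k u = pkind k v1.
    by move=> s's; have [u -> uv1] := peval_sub s's E1; exists u => //; exact: pkind_lsub uv1.
  case: (boolP (pkind k v1)) => kv1 E.
    apply: ensures_le (fun dH' => IH2 _ _ ds dH' E) dH _ _; first by lia.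
    by move=> s' /test[u -> ->]; rewrite kv1.
  apply: ensures_le (fun dH' => IH3 _ _ ds dH' E) dH _ _; first by lia.
  by move=> s' /test[u -> ->]; rewrite (negbTE kv1).
Qed.

(** The first summand bounds the total demand, with [H] taken to be [2 ^ (d + n)]; the second counts
    the atoms in the skeletons of [k] variables of depth at most [d]. *)
Definition atom_bound (n d k : nat) : nat := (2 ^ (d + n)).+2 ^ n + k * 2 ^ d.

Lemma small_counterexample e d s (xs : seq var) :
  bounded d s -> (forall x, isSome (s x) -> x \in xs) -> peval e s = None ->
  exists s' S, [/\ s' <=e s, peval e s' = None, size S <= atom_bound (esize e) d (size xs)
    & forall x u, s' x = Some u -> {subset patoms u <= S}].
Proof.
move=> ds s_xs Es; have [D szD [Ds DP]] := peval_undefined ds (leqnn _) Es.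
have [cut_s D_cut] := cut_envP Ds.
pose base x := if s x is Some v then patoms (pmin v) else [::].
exists (cut_env D s), (flatten [seq patoms p.2 | p <- D] ++ flatten [seq base x | x <- xs]).
split=> //; first exact: DP.
  rewrite size_cat; apply: leq_add.
    apply: leq_trans szD; rewrite /dsize; elim: (D) => //= p D' IH.
    by rewrite size_cat leq_add // size_patoms.
  elim: {s_xs} xs => //= x xs IH; rewrite size_cat mulSn leq_add //.
  rewrite /base; case sx: (s x) => [v|] //.
  apply: leq_trans (size_patoms _) _; apply: leq_trans (psize_pmin _) _.
  by rewrite leq_exp2l // (ds _ _ sx).
move=> x u; rewrite /cut_env; case sx: (s x) => [v|] //= [<-] a /patoms_cut.
rewrite mem_cat => /orP[av|/hasP[p pD ap]]; apply/orP; [right|left]; apply/flattenP.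
  exists (base x); last by rewrite /base sx.
  by apply: map_f; apply: s_xs; rewrite sx.
by exists (patoms p.2) => //; apply: map_f.
Qed.

End Counterexample.

(** * Largest values and environments over finitely many atoms *)

Definition lookup T (l : seq (var * T)) : penv T :=
  foldr (fun p s => upd p.1 p.2 s) (fun _ => None) l.

Section MaximalValues.
Variables (B : countType) (L : seq B).

Fixpoint tmax (t : nrctype) : seq (pre B) :=
  match t with
  | TEmpty => [::]
  | TAtom => map (@PAtom B) L
  | TProd t1 t2 => [seq PPair u v | u <- tmax t1, v <- tmax t2]
  | TUnion t1 t2 => tmax t1 ++ tmax t2
  | TColl t1 => [:: PColl (tmax t1)]
  end.

Fixpoint emax (g : seq (var * nrctype)) : seq (seq (var * pre B)) :=
  if g is (x, t) :: g' then
    [seq p :: s | p <- [seq (x, u) | u <- tmax t], s <- emax g']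
  else [:: [::]].

Lemma emax_lookup g s x : s \in emax g ->
  match lookup g x, lookup s x with
  | Some t, Some u => u \in tmax t
  | None, None => true
  | _, _ => false
  end.
Proof.
elim: g s => [|[y t] g IH] s /=; first by rewrite inE => /eqP->.
case/allpairsP=> -[p r] /= [/mapP[u ut ->] rg ->] /=.
by rewrite /upd; case: eqP => // _; exact: IH.
Qed.

End MaximalValues.

Fixpoint map_pre (A B : Type) (f : A -> B) (u : pre A) : pre B :=
  match u with
  | PAtom a => PAtom (f a)
  | PPair v w => PPair (map_pre f v) (map_pre f w)
  | PColl l => PColl (map (map_pre f) l)
  end.

Lemma lsub_map (A B : countType) (f : A -> B) u : lsub (fun a b => b == f a) u (map_pre f u).
Proof.
elim/pre_ind': u => [a|u v /= -> ->|l /pre_allP Hl] //=.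
apply/allP=> x xl; apply/hasP; exists (map_pre f x); last exact: Hl.
exact: map_f.
Qed.

Lemma ptype_map_tmax (A B : countType) (f : B -> A) L t u :
  u \in tmax L t -> ptype t (map_pre f u).
Proof.
elim: t u => //=.
- by move=> u /mapP[a _ ->].
- by move=> t1 IH1 t2 IH2 u /allpairsP[[v w] /= [/IH1 + /IH2 + ->]] /= => -> ->.
- by move=> t1 IH1 t2 IH2 u; rewrite mem_cat => /orP[/IH1|/IH2] ->; rewrite ?orbT.
- move=> t1 IH1 u; rewrite inE => /eqP-> /=.
  by rewrite all_map; apply/allP=> v /IH1.
Qed.

(** The guard [a \in S] makes the relation a partial injection as soon as [h] is injective on the
    atoms that occur, whatever it does elsewhere. *)
Lemma tmax_lsub (A B : countType) (S : seq A) (L : seq B) (h : A -> B) t u :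
  (forall a, a \in S -> h a \in L) -> ptype t u -> {subset patoms u <= S} ->
  exists2 v, v \in tmax L t & lsub (fun a b => (a \in S) && (b == h a)) u v.
Proof.
move=> hL; elim: t u => //=.
- move=> [a|//|//] _ aS; have {}aS : a \in S by apply: aS; rewrite /= mem_head.
  by exists (PAtom (h a)); rewrite /= ?eqxx ?aS // map_f // hL.
- move=> t1 IH1 t2 IH2 [//|u1 u2|//] /andP[/IH1 H1 /IH2 H2] /= uS.
  have [|v1 v1t uv1] := H1; first by move=> a au; apply: uS; rewrite mem_cat au.
  have [|v2 v2t uv2] := H2; first by move=> a au; apply: uS; rewrite mem_cat au orbT.
  by exists (PPair v1 v2); [apply: allpairs_f|rewrite /= uv1].
- move=> t1 IH1 t2 IH2 u /orP[/IH1 H|/IH2 H] /H[v vt uv]; exists v => //;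
    by rewrite mem_cat vt ?orbT.
- move=> t1 IH1 [//|//|l] /allP lt lS; exists (PColl (tmax L t1)); first exact: mem_head.
  apply/lsub_collP => u ul; apply: IH1; first exact: lt.
  by move=> a au; apply: lS => /=; apply/flattenP; exists (patoms u) => //; exact: map_f.
Qed.

Fixpoint leaves (t : tree) : nat :=
  if t is Node l r then leaves l + leaves r else 1.

Lemma leaves_gt0 t : 0 < leaves t.
Proof. by elim: t => //= l; lia. Qed.

Lemma pdepth_ptype (A : countType) t (u : pre A) : ptype t u -> pdepth u < leaves (enc_type t).
Proof.
elim: t u => //=.
- by case.
- by move=> t1 IH1 t2 IH2 [//|u1 u2|//] /andP[/IH1 + /IH2] /=; lia.
- by move=> t1 IH1 t2 IH2 u /orP[/IH1|/IH2]; lia.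
- move=> t1 IH1 [//|//|l] /allP lt.
  suff : pdepth (PColl l) <= (leaves (enc_type t1)).-1 by have := leaves_gt0 (enc_type t1); lia.
  by rewrite pdepth_coll; apply/allP => u /lt /IH1; lia.
Qed.

Definition well_typed (A : countType) (g : seq (var * nrctype)) (s : penv (pre A)) : Prop :=
  forall x, match lookup g x, s x with
            | Some t, Some u => ptype t u
            | None, None => true
            | _, _ => false
            end.

Lemma lookup_key T (l : seq (var * T)) x : isSome (lookup l x) = (x \in map fst l).
Proof.
by elim: l => //= -[y t] l IH; rewrite /upd inE; case: eqP.
Qed.

Lemma lookup_map (I : eqType) T (k : I -> var) (F : I -> T) r i :
  injective k -> i \in r -> lookup [seq (k i, F i) | i <- r] (k i) = Some (F i).
Proof.
move=> k_inj; elim: r => //= j r IH; rewrite /upd inE (inj_eq k_inj).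
by case: eqP => [->|].
Qed.

Lemma emax_lsub (A B : countType) (S : seq A) (L : seq B) (h : A -> B) g (s : penv (pre A)) :
  (forall a, a \in S -> h a \in L) ->
  well_typed g s -> (forall x u, s x = Some u -> {subset patoms u <= S}) ->
  uniq (map fst g) ->
  exists2 r, r \in emax L g & esub (fun a b => (a \in S) && (b == h a)) s (lookup r).
Proof.
move=> hL; elim: g s => [|[x t] g IH] s sg sS /=.
  move=> _; exists [::]; first by rewrite inE.
  by move=> x; have := sg x => /=; case: (s x).
(* The tail of the assignment does not mention [x], so [x] is removed from [s] to keep the domains
   equal. *)
case/andP=> xg ug; pose s' : penv (pre A) := fun y => if y == x then None else s y.
have [||r rg s'r] := IH s' _ _ ug.
- move=> y; rewrite /s'; case: eqP => [->|/eqP yx].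
    by have := lookup_key g x; rewrite (negbTE xg); case: lookup.
  by have := sg y; rewrite /= /upd (negbTE yx).
- by move=> y u; rewrite /s'; case: eqP => // _; exact: sS.
have := sg x; rewrite /= /upd eqxx; case sx: (s x) => [u|] // ut.
have [v vt uv] := tmax_lsub hL ut (sS _ _ sx).
exists ((x, v) :: r); first by apply: allpairs_f => //; exact: map_f.
move=> y; rewrite /= /upd; case: eqP => [->|/eqP yx]; first by rewrite sx.
by have := s'r y; rewrite /s' (negbTE yx).
Qed.

Lemma bounded_well_typed (A : countType) g d (s : penv (pre A)) :
  well_typed g s -> all (fun p => leaves (enc_type p.2) <= d.+1) g -> bounded d s.
Proof.
move=> sg gd x u sx; have := sg x; rewrite sx; case gx: (lookup g x) => [t|] //.
move=> /pdepth_ptype ut; suff : leaves (enc_type t) <= d.+1 by lia.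
elim: g gx gd {sg sx} => //= -[y t'] g IH /=; rewrite /upd.
by case: eqP => [_ [->] /andP[]|_ /IH H /andP[_ /H]].
Qed.

(** Keeps the cut-down counterexample within the type assignment. *)
Lemma ptype_sub (A : countType) t (u v : pre A) :
  lsub (@eq_op A) u v -> ptype t v -> ptype t u.
Proof.
elim: t u v => //=.
- by case=> [?|? ?|?] [?|? ?|?].
- move=> t1 IH1 t2 IH2 [?|u1 u2|?] [?|v1 v2|?] //= /andP[/IH1 H1 /IH2 H2].
  by move=> /andP[/H1 -> /H2].
- by move=> t1 IH1 t2 IH2 u v uv /orP[/(IH1 _ _ uv)|/(IH2 _ _ uv)] ->; rewrite ?orbT.
- move=> t1 IH1 [?|? ?|l] [?|? ?|m] // /lsub_collP lm /allP mt; apply/allP=> u /lm[v /mt vt uv].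
  exact: IH1 vt.
Qed.

(** If [s] fails, a small failing environment below it, with its atoms renamed injectively into [L],
    lies below a largest environment, which therefore fails too. Conversely, [f] turns largest
    environments over [L] into environments over [A]. *)
Theorem maximal_environments_suffice (A B : countType) (L : seq B) (f : B -> A) e g d :
  injective f -> uniq L -> uniq (map fst g) ->
  all (fun p => leaves (enc_type p.2) <= d.+1) g ->
  atom_bound (esize e) d (size g) <= size L ->
  all (fun r => isSome (peval e (lookup r))) (emax L g) <->
  (forall s : penv (pre A), well_typed g s -> isSome (peval e s)).
Proof.
move=> f_inj uL ug gd szL; split=> [/allP allL s sg|def].
  case Es: (peval e s) => [//|]; have [|s' [S [s's Es' szS sS]]] :=
    small_counterexample (xs := map fst g) (bounded_well_typed sg gd) _ Es.
    by move=> x; rewrite -lookup_key; have := sg x; case: lookup; case: (s x).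
  rewrite size_map in szS.
  have [b0 _] : exists b0 : B, b0 \in L.
    case: (L) szL => [|b0 L' _]; last by exists b0; exact: mem_head.
    by rewrite leqNgt addn_gt0 expn_gt0.
  (* Injective on [S], since [S] has at most [size L] entries and [L] no repetition; on [S] the
     default [b0] is never reached. *)
  pose h a := nth b0 L (index a S).
  have idx a : a \in S -> index a S < size L.
    by rewrite -index_mem => /leq_trans; apply; exact: leq_trans szL.
  have hL a : a \in S -> h a \in L by move=> /idx; exact: mem_nth.
  have s'g : well_typed g s'.
    move=> x; have := sg x; have := s's x; case: (s' x) => [u|]; case: (s x) => [v|] //.
    by move=> uv; case: lookup => // t; exact: ptype_sub.
  have [r rg s'r] := emax_lsub hL s'g sS ug.
  case Er: (peval e (lookup r)) (allL _ rg) => [v|] // _.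
  have [|u] := peval_lsub _ s'r Er; last by rewrite Es'.
  move=> a a' b b' /andP[aS /eqP->] /andP[a'S /eqP->].
  rewrite nth_uniq ?idx //; apply/eqP/eqP => [->//|eq_idx].
  by rewrite -(nth_index a aS) eq_idx nth_index.
apply/allP=> r rg; pose s x := omap (map_pre f) (lookup r x).
have Es : isSome (peval e s).
  apply: def => x; have := emax_lookup x rg; rewrite /s.
  by case: lookup => [t|]; case: lookup => //= u; exact: ptype_map_tmax.
case E: (peval e s) Es => [v|] // _.
have [|x|u ->//] := @peval_lsub _ _ (fun b a => a == f b) _ e (lookup r) s _ _ E.
  by move=> b b' a a' /eqP-> /eqP->; rewrite (inj_eq f_inj).
by rewrite /s; case: lookup => //= u; exact: lsub_map.
Qed.

(** * The program *)

Fixpoint tree_enc (t : tree) : GenTree.tree unit :=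
  if t is Node l r then GenTree.Node 0 [:: tree_enc l; tree_enc r] else GenTree.Leaf tt.

Fixpoint tree_dec (t : GenTree.tree unit) : tree :=
  if t is GenTree.Node _ [:: l; r] then Node (tree_dec l) (tree_dec r) else Leaf.

Lemma tree_encK : cancel tree_enc tree_dec.
Proof. by elim=> //= l -> r ->. Qed.

HB.instance Definition _ := Countable.copy tree (can_type tree_encK).

(* No value is encoded by [Leaf], which is left to stand for undefinedness.  The
right child of a set is [Leaf]; otherwise the left child of an atom is [Leaf]. *)
Fixpoint enc_pre (u : pre tree) : tree :=
  match u with
  | PAtom a => Node Leaf (Node Leaf a)
  | PPair v w => Node (enc_pre v) (enc_pre w)
  | PColl l => Node (enc_seq (map enc_pre l)) Leaf
  end.

Definition enc_opt (o : option (pre tree)) : tree := if o is Some u then enc_pre u else Leaf.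

Definition enc_env (r : seq (var * pre tree)) : tree :=
  enc_seq [seq Node (enc_nat p.1) (enc_pre p.2) | p <- r].

Definition enc_ctx (g : seq (var * nrctype)) : tree :=
  enc_seq [seq Node (enc_nat p.1) (enc_type p.2) | p <- g].

Fixpoint graft (t u : tree) : tree :=
  if t is Node l r then Node (graft l u) (graft r u) else u.

Fixpoint labels (t : tree) : seq tree :=
  if t is Node l r then [seq Node a b | a <- labels l, b <- labels r]
  else [:: Leaf; Node Leaf Leaf].

(* Terms with binders represented by functions: a [bterm] takes the length of
the environment it is run in, and variables are named by de Bruijn levels. *)
Definition bterm := nat -> term.
Definition bvar (l : nat) : bterm := fun d => MVar (d - l.+1).
Definition bleaf : bterm := fun _ => MLeaf.
Definition bnode (t u : bterm) : bterm := fun d => MNode (t d) (u d).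
Definition bcall (f : nat) (t : bterm) : bterm := fun d => MCall f (t d).
Definition bcase (t t1 : bterm) (t2 : bterm -> bterm -> bterm) : bterm :=
  fun d => MCase (t d) (t1 d) (t2 (bvar d.+1) (bvar d) d.+2).
Definition bfun (f : bterm -> bterm) : term := f (bvar 0) 1.

Definition bsplit t k := bcase t bleaf k.
Definition bif t t1 t2 := bcase t t2 (fun _ _ => t1).
Definition btrue := bnode bleaf bleaf.
Definition bone t := bnode t bleaf.

Fixpoint bswitch (t : bterm) (bs : seq bterm) : bterm :=
  if bs is b :: bs' then bcase t b (fun _ t' => bswitch t' bs') else bleaf.

Definition barg1 t k := bsplit t (fun a _ => k a).
Definition barg2 t k := bsplit t (fun a t => barg1 t (k a)).
Definition barg3 t k := bsplit t (fun a t => barg2 t (k a)).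
Definition barg4 t k := bsplit t (fun a t => barg3 t (k a)).

Definition bview t (ka ks : bterm -> bterm) (kp : bterm -> bterm -> bterm) : bterm :=
  bcase t bleaf (fun l r =>
    bcase r (ks l) (fun _ a => bcase l (ka a) (fun _ _ => kp l r))).
Definition bundef1 (_ : bterm) := bleaf.
Definition bundef2 (_ _ : bterm) := bleaf.
Definition bset t := bone t.
Definition bview_set t k := bview t bundef1 k bundef2.

Definition f_main := 0.
Definition f_append := 1.
Definition f_pairs := 2.
Definition f_prod := 3.
Definition f_graft := 4.
Definition f_labels := 5.
Definition f_types := 6.
Definition f_envs := 7.
Definition f_check := 8.
Definition f_eq := 9.
Definition f_lookup := 10.
Definition f_union := 11.
Definition f_flatten := 12.
Definition f_for := 13.
Definition f_kind := 14.
Definition f_eval := 15.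

Definition bcall2 f t u := bcall f (bnode t u).

Definition decider_source : program := [::
  (* main *) bfun (fun x => bsplit x (fun e g =>
    bcall2 f_check e (bcall2 f_envs (bcall f_labels (bcall2 f_graft x x)) g)));
  (* append *) bfun (fun x => bsplit x (fun l m =>
    bcase l m (fun a l' => bnode a (bcall2 f_append l' m))));
  (* pairs *) bfun (fun x => bsplit x (fun a m =>
    bcase m bleaf (fun b m' => bnode (bnode a b) (bcall2 f_pairs a m'))));
  (* prod *) bfun (fun x => bsplit x (fun l m =>
    bcase l bleaf (fun a l' => bcall2 f_append (bcall2 f_pairs a m) (bcall2 f_prod l' m))));
  (* graft *) bfun (fun x => bsplit x (fun t u =>
    bcase t u (fun l r => bnode (bcall2 f_graft l u) (bcall2 f_graft r u))));
  (* labels *) bfun (fun t =>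
    bcase t (bnode bleaf (bnode btrue bleaf)) (fun l r =>
      bcall2 f_prod (bcall f_labels l) (bcall f_labels r)));
  (* types *) bfun (fun x => bsplit x (fun l t => bsplit t (fun c args => bswitch c [::
    bleaf;
    (* Pairing twice with the one-element list of [Leaf] turns each label into the code of an
       atom. *)
    bcall2 f_prod (bone bleaf) (bcall2 f_prod (bone bleaf) l);
    barg2 args (fun t1 t2 =>
      bcall2 f_prod (bcall2 f_types l t1) (bcall2 f_types l t2));
    barg2 args (fun t1 t2 =>
      bcall2 f_append (bcall2 f_types l t1) (bcall2 f_types l t2));
    barg1 args (fun t1 => bone (bset (bcall2 f_types l t1)))])));
  (* envs *) bfun (fun x => bsplit x (fun l g =>
    bcase g (bone bleaf) (fun p g' => bsplit p (fun y t =>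
      bcall2 f_prod (bcall2 f_prod (bone y) (bcall2 f_types l t)) (bcall2 f_envs l g')))));
  (* check *) bfun (fun x => bsplit x (fun e rs =>
    bcase rs btrue (fun r rs' =>
      bif (bcall2 f_eval e r) (bcall2 f_check e rs') bleaf)));
  (* eq *) bfun (fun x => bsplit x (fun t u =>
    bcase t (bcase u btrue (fun _ _ => bleaf)) (fun t1 t2 =>
      bcase u bleaf (fun u1 u2 => bif (bcall2 f_eq t1 u1) (bcall2 f_eq t2 u2) bleaf))));
  (* lookup *) bfun (fun x => bsplit x (fun y r =>
    bcase r bleaf (fun p r' => bsplit p (fun z u =>
      bif (bcall2 f_eq y z) u (bcall2 f_lookup y r')))));
  (* union *) bfun (fun x => bsplit x (fun u v =>
    bview_set u (fun l => bview_set v (fun m => bset (bcall2 f_append l m)))));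
  (* flatten *) bfun (fun l =>
    bcase l (bset bleaf) (fun u l' => bcall2 f_union u (bcall f_flatten l')));
  (* for *) bfun (fun x => bsplit x (fun ey rl => bsplit ey (fun e y => bsplit rl (fun r l =>
    bcase l (bset bleaf) (fun u l' =>
      bcall2 f_union
        (* A defined result is wrapped as a one-element set; an undefined one is [Leaf], which
           [f_union] propagates. *)
        (bcase (bcall2 f_eval e (bnode (bnode y u) r)) bleaf (fun v w => bset (bone (bnode v w))))
        (bcall2 f_for ey (bnode r l')))))));
  (* kind *) bfun (fun x => bsplit x (fun k u => bsplit k (fun c args => bswitch c [::
    bview u (fun _ => btrue) bundef1 bundef2;
    bview u bundef1 (fun _ => btrue) bundef2;
    barg2 args (fun k1 k2 => bview u bundef1 bundef1 (fun u1 u2 =>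
      bif (bcall2 f_kind k1 u1) (bcall2 f_kind k2 u2) bleaf));
    barg2 args (fun k1 k2 => bif (bcall2 f_kind k1 u) btrue (bcall2 f_kind k2 u))])));
  (* eval *) bfun (fun x => bsplit x (fun e r => let ev e := bcall2 f_eval e r in
   bsplit e (fun c args => bswitch c [::
    barg1 args (fun y => bcall2 f_lookup y r);
    barg2 args (fun e1 e2 => bcase (ev e1) bleaf (fun u v =>
      bcase (ev e2) bleaf (fun u' v' => bnode (bnode u v) (bnode u' v'))));
    barg1 args (fun e1 => bview (ev e1) bundef1 bundef1 (fun u v => u));
    barg1 args (fun e1 => bview (ev e1) bundef1 bundef1 (fun u v => v));
    bset bleaf;
    barg1 args (fun e1 => bcase (ev e1) bleaf (fun u v => bset (bone (bnode u v))));
    barg2 args (fun e1 e2 => bcall2 f_union (ev e1) (ev e2));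
    barg1 args (fun e1 => bview_set (ev e1) (bcall f_flatten));
    barg3 args (fun e2 y e1 =>
      bview_set (ev e1) (fun l => bcall2 f_for (bnode e2 y) (bnode r l)));
    barg4 args (fun e1 e2 e3 e4 =>
      bview (ev e1) (fun a => bview (ev e2) (fun b =>
        bif (bcall2 f_eq a b) (ev e3) (ev e4)) bundef1 bundef2) bundef1 bundef2);
    barg4 args (fun e1 k e2 e3 => bcase (ev e1) bleaf (fun u v =>
      bif (bcall2 f_kind k (bnode u v)) (ev e2) (ev e3)))])))
].

(** Computing away the [bterm] combinators leaves plain first-order terms, on which [run] can
    match. *)
Definition decider : program := Eval compute in decider_source.

(** [exec] is a big-step relation, so every proof of [fn] also establishes termination. *)
Definition fn (f : nat) (v w : tree) : Prop :=
  exists2 body, onth decider f = Some body & exec decider [:: v] body w.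

Lemma exec_call env f t v w : exec decider env t v -> fn f v w -> exec decider env (MCall f t) w.
Proof. by move=> tv [body pf bw]; exact: ExCall bw. Qed.

Lemma exec_eq env t v w : exec decider env t v -> v = w -> exec decider env t w.
Proof. by move=> + <-. Qed.

Create HintDb fn.

Ltac run :=
  lazymatch goal with
  | |- exec _ _ (MVar _) _ => apply: ExVar; reflexivity
  | |- exec _ _ MLeaf _ => apply: ExLeaf
  | |- exec _ _ (MNode _ _) _ => apply: ExNode; [run|run]
  | |- exec _ _ (MCall _ _) _ => eapply exec_call; [run|by eauto with fn nocore]
  | |- exec _ _ (MCase _ _ _) _ =>
      first [ eapply ExCaseNode; [solve [run]|] | eapply ExCaseLeaf; [solve [run]|] ]; run
  end.

Ltac run_fn := eexists; [reflexivity|eapply exec_eq; [run|]].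

(** * Correctness of the functions of the program *)

Lemma append_fn l m : fn f_append (Node (enc_seq l) (enc_seq m)) (enc_seq (l ++ m)).
Proof. by elim: l => [|a l IH]; run_fn. Qed.
#[local] Hint Resolve append_fn : fn.

Lemma pairs_fn a m : fn f_pairs (Node a (enc_seq m)) (enc_seq [seq Node a b | b <- m]).
Proof. by elim: m => [|b m IH]; run_fn. Qed.
#[local] Hint Resolve pairs_fn : fn.

Lemma prod_fn l m :
  fn f_prod (Node (enc_seq l) (enc_seq m)) (enc_seq [seq Node a b | a <- l, b <- m]).
Proof. by elim: l => [|a l IH]; run_fn. Qed.
#[local] Hint Resolve prod_fn : fn.

Lemma graft_fn t u : fn f_graft (Node t u) (graft t u).
Proof. by elim: t => [|l IHl r IHr]; run_fn. Qed.
#[local] Hint Resolve graft_fn : fn.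

Lemma labels_fn t : fn f_labels t (enc_seq (labels t)).
Proof. by elim: t => [|l IHl r IHr]; run_fn. Qed.
#[local] Hint Resolve labels_fn : fn.
(** A list built by [bone] is a literal [Node], not syntactically an [enc_seq], hence a separate
    hint. *)
Lemma prod1_fn a m : fn f_prod (Node (Node a Leaf) (enc_seq m)) (enc_seq [seq Node a b | b <- m]).
Proof. by have := prod_fn [:: a] m; rewrite /= cats0. Qed.
#[local] Hint Resolve prod1_fn : fn.

Lemma types_fn L t :
  fn f_types (Node (enc_seq L) (enc_type t)) (enc_seq (map enc_pre (tmax L t))).
Proof.
elim: t => [||t1 IH1 t2 IH2|t1 IH1 t2 IH2|t1 IH1]; run_fn => //.
- by rewrite /= -!map_comp.
- by rewrite /= map_allpairs allpairs_mapl allpairs_mapr.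
- by rewrite /= map_cat.
Qed.
#[local] Hint Resolve types_fn : fn.

Lemma envs_fn L g :
  fn f_envs (Node (enc_seq L) (enc_ctx g)) (enc_seq (map enc_env (emax L g))).
Proof.
elim: g => [|[x t] g IH]; run_fn => //=.
by rewrite map_allpairs -map_comp !allpairs_mapl allpairs_mapr.
Qed.
#[local] Hint Resolve envs_fn : fn.

Lemma eq_fn a b : fn f_eq (Node a b) (enc_bool (a == b)).
Proof.
elim: a b => [|a1 IH1 a2 IH2] [|b1 b2]; try by run_fn.
have -> : (Node a1 a2 == Node b1 b2) = (a1 == b1) && (a2 == b2).
  by apply/eqP/andP => [[-> ->]|[/eqP-> /eqP->]].
have := IH1 b1; case: (a1 == b1) => H; have {}IH2 := IH2 b2.
  by run_fn.
by run_fn.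
Qed.

Lemma eq_nat_fn x y : fn f_eq (Node (enc_nat x) (enc_nat y)) (enc_bool (x == y)).
Proof.
have -> : (x == y) = (enc_nat x == enc_nat y); last exact: eq_fn.
by elim: x y => [|x IH] [|y] //; rewrite eqSS IH /=; apply/eqP/eqP => [->|[]].
Qed.

Lemma lookup_fn x r :
  fn f_lookup (Node (enc_nat x) (enc_env r)) (enc_opt (lookup r x)).
Proof.
elim: r => [|[y u] r IH]; first by run_fn.
have := eq_nat_fn x y; rewrite /= /upd; case: eqP => _ H.
  by run_fn.
by run_fn.
Qed.
#[local] Hint Resolve lookup_fn : fn.

(** [run] resolves an [MCase] only on a visible [Leaf] or [Node]; this exposes the root of a code
    and separates it from undefinedness. *)
Lemma enc_preP u : exists l r, enc_pre u = Node l r.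
Proof. by case: u => *; do 2!eexists. Qed.

(** Strict in both arguments, so that one function serves unions and the steps of flattening and
    comprehension, where one undefined element spoils the whole. *)
Definition punion (o o' : option (pre tree)) : option (pre tree) :=
  if (o, o') is (Some (PColl l), Some (PColl m)) then Some (PColl (l ++ m)) else None.

Lemma union_fn o o' : fn f_union (Node (enc_opt o) (enc_opt o')) (enc_opt (punion o o')).
Proof.
case: o => [[a|u1 u2|l]|]; try by run_fn.
  have [? [? E1]] := enc_preP u1; have [? [? E2]] := enc_preP u2.
  by rewrite /= E1 E2; run_fn.
case: o' => [[a|u1 u2|m]|]; try by run_fn.
  have [? [? E1]] := enc_preP u1; have [? [? E2]] := enc_preP u2.
  by rewrite /= E1 E2; run_fn.
by run_fn; rewrite //= map_cat.
Qed.

Lemma flatten_fn l :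
  fn f_flatten (enc_seq (map enc_pre l))
    (enc_opt (omap (fun ll => PColl (flatten ll)) (omapM (@pset _) l))).
Proof.
elim: l => [|u l IH]; first by run_fn.
have /= H := union_fn (Some u) (omap (fun ll => PColl (flatten ll)) (omapM (@pset _) l)).
run_fn; congr enc_opt.
rewrite /= -/(omapM _ l); case: u {H} => //= m.
by case: (omapM _ l).
Qed.
#[local] Hint Resolve flatten_fn : fn.

(** [f_eval] and [f_for] call each other. The hypothesis is the induction hypothesis of [eval_fn]
    for the body, in all environments. *)
Lemma for_fn e y r l :
  (forall r, fn f_eval (Node (enc_expr e) (enc_env r)) (enc_opt (peval e (lookup r)))) ->
  fn f_for (Node (Node (enc_expr e) (enc_nat y)) (Node (enc_env r) (enc_seq (map enc_pre l))))
    (enc_opt (omap (@PColl _) (omapM (fun v => peval e (upd y v (lookup r))) l))).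
Proof.
move=> He; elim: l => [|u l IH]; first by run_fn.
have Hu := He ((y, u) :: r).
have /= := union_fn (if peval e (lookup ((y, u) :: r)) is Some v then Some (PColl [:: v]) else None)
  (omap (@PColl _) (omapM (fun v => peval e (upd y v (lookup r))) l)).
move: Hu; rewrite /= -/(lookup r) -/(omapM _ l).
case: (peval e _) => [v|] /= Hu H.
  have [vl [vr Ev]] := enc_preP v; rewrite Ev in Hu H.
  run_fn; congr enc_opt.
  by case: (omapM _ l).
by run_fn.
Qed.

Lemma kind_fn k u : fn f_kind (Node (enc_kind k) (enc_pre u)) (enc_bool (pkind k u)).
Proof.
elim: k u => [||k1 IH1 k2 IH2|k1 IH1 k2 IH2] u.
- case: u => [a|u1 u2|l]; try by run_fn.
  have [? [? E1]] := enc_preP u1; have [? [? E2]] := enc_preP u2.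
  by rewrite /= E1 E2; run_fn.
- case: u => [a|u1 u2|l]; try by run_fn.
  have [? [? E1]] := enc_preP u1; have [? [? E2]] := enc_preP u2.
  by rewrite /= E1 E2; run_fn.
- case: u => [a|u1 u2|l]; try by run_fn.
  have := IH1 u1; have := IH2 u2; rewrite /=.
  have [? [? E1]] := enc_preP u1; have [? [? E2]] := enc_preP u2; rewrite E1 E2 => H2.
  by case: (pkind k1 u1) => H1; run_fn.
- have := IH1 u; have := IH2 u => /= H2.
  by case: (pkind k1 u) => H1; run_fn.
Qed.

Lemma eval_fn e r : fn f_eval (Node (enc_expr e) (enc_env r)) (enc_opt (peval e (lookup r))).
Proof.
elim: e r => [x|e1 IH1 e2 IH2|e1 IH1|e1 IH1||e1 IH1|e1 IH1 e2 IH2|e1 IH1|e2 IH2 x e1 IH1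
  |e1 IH1 e2 IH2 e3 IH3 e4 IH4|e1 IH1 k e2 IH2 e3 IH3] r.
- by run_fn.
- have := IH1 r; have := IH2 r => /=.
  case: (peval e1 _) => [u|] /= H2 H1; last by run_fn.
  have [? [? E1]] := enc_preP u; rewrite E1 in H1.
  case: (peval e2 _) H2 => [v|] /= H2; last by run_fn.
  have [? [? E2]] := enc_preP v; rewrite E2 in H2.
  by run_fn; rewrite E1 E2.
- have := IH1 r => /=; case: (peval e1 _) => [[a|u v|l]|] /= H1; try by run_fn.
  have [? [? E1]] := enc_preP u; have [? [? E2]] := enc_preP v; rewrite E1 E2 in H1.
  by run_fn.
- have := IH1 r => /=; case: (peval e1 _) => [[a|u v|l]|] /= H1; try by run_fn.
  have [? [? E1]] := enc_preP u; have [? [? E2]] := enc_preP v; rewrite E1 E2 in H1.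
  by run_fn.
- by run_fn.
- have := IH1 r => /=; case: (peval e1 _) => [u|] /= H1; last by run_fn.
  have [? [? E1]] := enc_preP u; rewrite E1 in H1.
  by run_fn; rewrite E1.
- have := IH1 r; have := IH2 r => H2 H1.
  have H := union_fn (peval e1 (lookup r)) (peval e2 (lookup r)).
  by run_fn.
- have := IH1 r => /=; case: (peval e1 _) => [[a|u v|l]|] /= H1; try by run_fn.
  have [? [? E1]] := enc_preP u; have [? [? E2]] := enc_preP v; rewrite E1 E2 in H1.
  by run_fn.
- have Hfor := @for_fn e2 x r _ IH2.
  have := IH1 r => /=; case: (peval e1 _) => [[a|u v|l]|] /= H1; try by run_fn.
  have [? [? E1]] := enc_preP u; have [? [? E2]] := enc_preP v; rewrite E1 E2 in H1.
  by run_fn.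
- have := IH1 r; have := IH2 r; have := IH3 r; have := IH4 r => /= H4 H3 H2.
  case: (peval e1 _) => [[a|u v|l]|] /= H1; try by run_fn.
    case: (peval e2 _) H2 => [[b|u v|l]|] /= H2; try by run_fn.
      have := eq_fn a b; case: (a == b) => H; by run_fn.
    have [? [? E1]] := enc_preP u; have [? [? E2]] := enc_preP v; rewrite E1 E2 in H2.
    by run_fn.
  have [? [? E1]] := enc_preP u; have [? [? E2]] := enc_preP v; rewrite E1 E2 in H1.
  by run_fn.
- have := IH1 r; have := IH2 r; have := IH3 r => /= H3 H2.
  case: (peval e1 _) => [u|] /= H1; last by run_fn.
  have := kind_fn k u; have [? [? E1]] := enc_preP u; rewrite E1 in H1 *.
  by case: (pkind k u) => H; run_fn.
Qed.

Lemma check_fn e rs :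
  fn f_check (Node (enc_expr e) (enc_seq (map enc_env rs)))
    (enc_bool (all (fun r => isSome (peval e (lookup r))) rs)).
Proof.
elim: rs => [|r rs IH]; first by run_fn.
have /= := eval_fn e r; case: (peval e _) => [u|] /= H; last by run_fn.
by have [? [? E]] := enc_preP u; rewrite E in H; run_fn.
Qed.
#[local] Hint Resolve check_fn : fn.

(** Grafting [x] onto itself squares the number [N] of leaves, giving [2 ^ (N * N)] labels; the
    exponent needed to bound [atom_bound] is quadratic. *)
Definition atoms_for (x : tree) : seq tree := labels (graft x x).

Lemma main_fn e g : let x := Node (enc_expr e) (enc_ctx g) in
  fn f_main x
    (enc_bool (all (fun r => isSome (peval e (lookup r))) (emax (atoms_for x) g))).
Proof. by move=> x; run_fn. Qed.

(** * Decidability *)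

Lemma size_labels t : size (labels t) = 2 ^ leaves t.
Proof. by elim: t => //= l IHl r IHr; rewrite size_allpairs IHl IHr expnD. Qed.

Lemma uniq_labels t : uniq (labels t).
Proof.
by elim: t => //= l IHl r IHr; apply: allpairs_uniq => // -[a b] [a' b'] _ _ [-> ->].
Qed.

Lemma leaves_graft t u : leaves (graft t u) = leaves t * leaves u.
Proof. by elim: t => /= [|l -> r ->]; lia. Qed.

Lemma esize_leaves e : 2 * esize e <= leaves (enc_expr e).
Proof. by elim: e => /= *; lia. Qed.

Lemma size_ctx_leaves g : size g < leaves (enc_ctx g).
Proof.
elim: g => //= -[x t] g IH; have := leaves_gt0 (enc_nat x); have := leaves_gt0 (enc_type t).
by rewrite /enc_ctx /= in IH *; lia.
Qed.

Lemma type_ctx_leaves g : all (fun p => leaves (enc_type p.2) <= (leaves (enc_ctx g)).+1) g.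
Proof.
(* [d] is fixed for the induction, since the tail of [g] has fewer leaves. *)
suff H d : leaves (enc_ctx g) <= d -> all (fun p => leaves (enc_type p.2) <= d.+1) g by exact: H.
elim: g => //= -[x t] g IH; rewrite -/(enc_ctx g) /= => gd.
by apply/andP; split; [lia|apply: IH; lia].
Qed.

(** Each summand is at most half of the bound: the exponents [(d + n).+1 * n] and [2 * d] are below
    [N * N]. *)
Lemma atom_bound_le n d k N : 0 < n -> 2 * n + d <= N -> k < d -> atom_bound n d k <= 2 ^ (N * N).
Proof.
move=> n0 nN kd; rewrite /atom_bound.
have le1 : (2 ^ (d + n)).+2 ^ n <= 2 ^ ((d + n).+1 * n).
  rewrite expnM; rewrite leq_exp2r //.
  rewrite expnS; have : 2 ^ 1 <= 2 ^ (d + n) by rewrite leq_exp2l //; lia.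
  by lia.
have le2 : k * 2 ^ d <= 2 ^ (2 * d).
  by rewrite mul2n -addnn expnD leq_mul2r orbC ltnW //; apply: leq_trans (ltn_expl d _) => //; lia.
have -> : N * N = (N * N).-1.+1 by nia.
rewrite expnS mul2n -addnn; apply: leq_add.
  by apply: leq_trans le1 _; rewrite leq_exp2l //; nia.
by apply: leq_trans le2 _; rewrite leq_exp2l //; nia.
Qed.

Section Assignment.
Local Open Scope fset_scope.
Local Open Scope fmap_scope.
Local Open Scope quotient_scope.
Variables (A : countType) (G : {fmap var -> nrctype}).

Definition ctx_of : seq (var * nrctype) := [seq (val x, G x) | x : domf G].

Lemma enc_ctx_of : enc_assignment G = enc_ctx ctx_of.
Proof. by rewrite /enc_ctx /ctx_of -map_comp. Qed.

Lemma uniq_ctx_of : uniq (map fst ctx_of).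
Proof. by rewrite -map_comp map_inj_uniq ?enum_uniq //; exact: val_inj. Qed.

Lemma lookup_ctx_of x : lookup ctx_of x = G.[? x].
Proof.
case: fndP => [xG|xG].
  rewrite -[x]/(val [` xG]) lookup_map ?mem_enum //; exact: val_inj.
have := lookup_key ctx_of x; rewrite -map_comp; case: lookup => // t /esym/mapP[y _ xy].
by move: xG; rewrite xy (valP y).
Qed.

Lemma well_definedP e :
  well_defined A e G <-> forall s : penv (pre A), well_typed ctx_of s -> isSome (peval e s).
Proof.
split=> [H s sG|H s [domsG sG]].
  (* [s] is defined on the whole domain of [G], so this default never shows. *)
  pose v0 := \pi_(value A) (PColl [::]).
  pose s' := [fmap x : domf G => odflt v0 (omap (fun u => \pi_(value A) u) (s (val x)))].
  have s'P x : s'.[? x] = omap (fun u => \pi_(value A) u) (s x).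
    have := sG x; rewrite lookup_ctx_of; case: (fndP G) => xG.
      rewrite (in_fnd (xG : x \in domf s')) ffunE /=.
      by case: (s x).
    by rewrite not_fnd //; case: (s x).
  have := H s'; rewrite (eval_cls _ s'P) => H'.
  case: (peval e s) H' => // H'; apply: H'; split=> // x v t; rewrite s'P -lookup_ctx_of.
  have := sG x; case: (s x) => //= u + [<-] xt; rewrite xt in_type_cls; exact.
pose p x := omap (fun v : value A => repr v) s.[? x].
have sP x : s.[? x] = omap (fun u => \pi_(value A) u) (p x).
  by rewrite /p; case: fnd => //= v; rewrite reprK.
rewrite (eval_cls _ sP); have : isSome (peval e p); last by case: peval.
apply: H => x; rewrite lookup_ctx_of /p; have := sG x.
case: fndP => xs; case: fndP => xG //.
- by move=> /(_ _ _ erefl erefl); rewrite -{1}[s.[xs]]reprK in_type_cls.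
- by move: xG; rewrite -domsG xs.
- by move: xs; rewrite domsG xG.
Qed.

End Assignment.

Theorem corollary5 (A : countType) (A_infinite : exists f : nat -> A, injective f) :
  exists p : program,
    forall (e : expr) (G : {fmap var -> nrctype}),
      domf G = FV e ->
      exists b : bool,
        computes p (enc_input e G) (enc_bool b) /\
        (b = true <-> well_defined A e G).
Proof.
case: A_infinite => f f_inj; exists decider => e G _.
pose x := Node (enc_expr e) (enc_ctx (ctx_of G)).
exists (all (fun r => isSome (peval e (lookup r))) (emax (atoms_for x) (ctx_of G))); split.
  rewrite /computes /enc_input enc_ctx_of.
  apply: exec_call (main_fn e (ctx_of G)); exact: ExVar.
apply: iff_trans (iff_sym (well_definedP A G e)).
(* The atoms of the program are trees; numbering them and applying [f] embeds them in [A]. *)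
have fp_inj : injective (f \o choice.pickle : tree -> A).
  by apply: inj_comp f_inj _; exact: pcan_inj choice.pickleK.
(* The depth bound [d] is the number of leaves of the encoded assignment. *)
apply: (maximal_environments_suffice fp_inj) (uniq_ctx_of G) (type_ctx_leaves _) _.
  exact: uniq_labels.
rewrite size_labels leaves_graft; apply: atom_bound_le; first exact: esize_gt0.
  by rewrite /x /=; have := esize_leaves e; lia.
exact: size_ctx_leaves.
Qed.
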